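(* A generic quartic curve in $\mathbb{P}^2_{\mathbb{C}}$ is the adjoint curve of at least $864$ complex $7$-gons.
   Context: A complex $7$-gon (heptagon) is given by seven complex lines $C_1,\dots,C_7\subset\mathbb{P}^2$ in cyclic order with vertices $v_{i,i+1}=C_i\cap C_{i+1}$ (indices modulo $7$), the lines being in general position (pairwise distinct, no three concurrent); two such data define the same $7$-gon if they differ by relabelling by the dihedral group $D_7$ of order $14$. Its residual points are the $14$ intersection points $C_i\cap C_j$ that are not vertices, and its adjoint curve is the unique quartic curve passing through these $14$ points. ''Generic'' means: for all quartics in a non-empty Zariski open subset of $\mathbb{P}(\mathbb{C}[x,y,z]_4)$. *)

(* Defs.v *)
From HB Require Import structures.
From mathcomp Require Import all_boot all_order all_algebra.
From mathcomp Require Import mpoly.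

Set Implicit Arguments.
Unset Strict Implicit.
Unset Printing Implicit Defensive.

Import GRing.Theory.
Local Open Scope ring_scope.

(* The projective plane over K is P(K^3): its points and lines are the        *)
(* subspaces of K^3 of dimension 1 and 2, and two lines meet in their :&:.    *)

Section Heptagons.

Variable K : fieldType.

Implicit Types (P : {vspace 'rV[K]_3}) (C D : 'Z_7 -> {vspace 'rV[K]_3}).
Implicit Types (q : {mpoly K[3]}).

(* In the last clause dimension 0 means that the three lines share no point. *)
Definition heptagon C : Prop :=
  [/\ forall i, \dim (C i) = 2%N,
      forall i j, i != j -> C i <> C j
    & forall i j k, i != j -> i != k -> j != k ->
        \dim (C i :&: C j :&: C k)%VS = 0%N].

(* C and D differ by an element of the dihedral group acting on Z/7 through   *)
(* the rotations i |-> k + i and the reflections i |-> k - i.                 *)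
Definition same_heptagon C D : Prop :=
  exists k : 'Z_7,
    (forall i, D i = C (k + i)) \/ (forall i, D i = C (k - i)).

Definition vertex C (i : 'Z_7) : {vspace 'rV[K]_3} := (C i :&: C (i + 1)%R)%VS.

Definition residual_point C P : Prop :=
  (exists i j : 'Z_7, i != j /\ P = (C i :&: C j)%VS)
  /\ forall k : 'Z_7, P <> vertex C k.

Definition passes_through q P : Prop :=
  forall v : 'rV[K]_3, v \in P -> q.@[fun j => v 0 j] = 0.

(* A quartic curve is represented by a nonzero form; proportional forms       *)
(* represent the same curve, i.e. the same point of P(K[x,y,z]_4).            *)
Definition quartic q : Prop := q != 0 /\ q \is 4.-homog.

Definition adjoint_curve C q : Prop :=
  [/\ quartic q,
      forall P, residual_point C P -> passes_through q P
    & forall q', quartic q' ->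
        (forall P, residual_point C P -> passes_through q' P) ->
        exists c : K, q' = c *: q].

End Heptagons.

Definition monom3 (a b c : nat) : 'X_{1..3} := [multinom [tuple a; b; c]].

Definition quartic_monomials : 15.-tuple 'X_{1..3} :=
  [tuple monom3 4 0 0; monom3 3 1 0; monom3 3 0 1; monom3 2 2 0;
         monom3 2 1 1; monom3 2 0 2; monom3 1 3 0; monom3 1 2 1;
         monom3 1 1 2; monom3 1 0 3; monom3 0 4 0; monom3 0 3 1;
         monom3 0 2 2; monom3 0 1 3; monom3 0 0 4].

Lemma monom3E (m : 'X_{1..3}) :
  m = monom3 (m ord0) (m (inord 1)) (m (inord 2)).
Proof.
apply/mnmP => -[[|[|[|//]]] Hi]; rewrite multinomE (tnth_nth 0%N) /=; congr (m _);
  by apply/val_inj; rewrite /= ?inordK.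
Qed.

Lemma mdeg_monom3 a b c : mdeg (monom3 a b c) = (a + b + c)%N.
Proof. by rewrite mdegE !big_ord_recr big_ord0 /= !multinomE !(tnth_nth 0%N). Qed.

Lemma quartic_monomials_uniq : uniq quartic_monomials.
Proof. by []. Qed.

Lemma mem_quartic_monomials (m : 'X_{1..3}) :
  (m \in (quartic_monomials : seq _)) = (mdeg m == 4).
Proof.
rewrite (monom3E m) mdeg_monom3.
move: (m ord0) (m (inord 1)) (m (inord 2)) => a b c.
by move: a b c => [|[|[|[|[|a]]]]] [|[|[|[|[|b]]]]] [|[|[|[|[|c]]]]].
Qed.

Section Zariski.

Variable K : fieldType.

Definition quartic_coeffs (q : {mpoly K[3]}) (i : 'I_15) : K :=
  q@_(tnth quartic_monomials i).

(* Subsets of P(K[x,y,z]_4) = P^14 are predicates on nonzero quartic forms;   *)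
(* the open ones are the complements of the common zero loci of families S of *)
(* homogeneous polynomials in the 15 coefficients.                            *)
Definition zariski_open (U : {mpoly K[3]} -> Prop) : Prop :=
  exists S : {mpoly K[15]} -> Prop,
    (forall F, S F -> exists d, F \is d.-homog) /\
    (forall q, quartic q ->
       (U q <-> exists2 F, S F & F.@[quartic_coeffs q] != 0)).

Definition generic_quartic (A : {mpoly K[3]} -> Prop) : Prop :=
  exists U : {mpoly K[3]} -> Prop,
    [/\ zariski_open U,
        exists2 q, quartic q & U q
      & forall q, quartic q -> U q -> A q].

End Zariski.

(* Main.v *)
Require Import Defs.
From HB Require Import structures.
From Stdlib Require Import ZArith.
From mathcomp Require Import boolp classical_sets.
From mathcomp Require Import all_boot all_order all_algebra closed_field.
From mathcomp Require Import reals complex mpoly.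
From mathcomp Require Import ssrZ zify ring lra.

Set Implicit Arguments.
Unset Strict Implicit.
Unset Printing Implicit Defensive.

Import Order.TTheory GRing.Theory Num.Theory.
Local Open Scope complex_scope.
Local Open Scope ring_scope.

(** The Fermat quartic x^4 + y^4 + z^4 is the adjoint curve of 864 heptagons.
They form nine free orbits under the group of order 96 generated by the
permutations of the coordinates and the multiplications of a coordinate by i.
One approximate representative per orbit is certified by a contraction argument
in exact integer ball arithmetic, with enough slack for the argument to survive
a small change of the quartic; so every quartic close to the Fermat quartic is
the adjoint curve of 864 heptagons. Being the adjoint curve of 864 heptagons is
a first-order condition on the coefficients. By quantifier elimination over the
complex numbers it has the same truth value at all points off some
hypersurface, and a hypersurface contains no ball. *)

(** * Zeros of polynomials *)

(** Seven lines in the chart (x : y : 1) have 14 coordinates and satisfy 14 equations, one per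
    residual point, so the system is square and Newton's method applies. The Fermat quartic is
    chosen for its symmetry, which leaves 9 = 864 / 96 systems to certify. A nearby quartic has no
    symmetry, but the group fixes the Fermat quartic and acts on coefficients by permutations and
    factors of modulus 1, so every twist of a nearby quartic is just as near; a heptagon for the
    twist, found in one of nine boxes, is moved by the group element to one for the quartic itself.
    Distinctness is certified in a form that survives perturbation and ignores labels: some line of
    one heptagon is not a line of the other. Uniqueness of the adjoint quartic is pure algebra, by
    counting roots on lines. The hypersurface given by quantifier elimination lives in the affine
    space of coefficients and need not be a cone, so the open set of quartics is defined by its
    homogeneous parts. *)

Lemma base_expansion_inj N n (a b : 'I_n -> nat) :
  (forall i, (a i < N)%N) -> (forall i, (b i < N)%N) ->
  (\sum_i a i * N ^ i = \sum_i b i * N ^ i)%N -> a =1 b.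
Proof.
elim: n a b => [a b _ _ _ []//|n IH a b aN bN].
have lowE (c : 'I_n.+1 -> nat) : (\sum_i c i * N ^ i =
    (\sum_i c (lift ord0 i) * N ^ i) * N + c ord0)%N.
  rewrite big_ord_recl muln1 addnC big_distrl; congr addn.
  by apply: eq_bigr => i _; rewrite lift0 expnSr mulnA.
have N0 : (0 < N)%N by apply: leq_ltn_trans (aN ord0).
rewrite !lowE => eq_ab.
have eq0 : a ord0 = b ord0.
  by have := congr1 (modn^~ N) eq_ab; rewrite !modnMDl !modn_small.
have := congr1 (divn^~ N) eq_ab.
rewrite !divnMDl // !divn_small // !addn0 => /IH eqS i.
case: (unliftP ord0 i) => [j|] -> //.
by apply: eqS => k; [apply: aN|apply: bN].
Qed.

Section Nonvanishing.

Variable K : numFieldType.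

Lemma poly_nonroot (p : {poly K}) (f : nat -> K) :
  p != 0 -> injective f -> exists k, ~~ root p (f k).
Proof.
move=> p0 fI; have [allr|] := boolP (all (root p) (map f (iota 0 (size p)))).
  have := max_poly_roots p0 allr; rewrite map_inj_uniq // iota_uniq.
  by move=> /(_ isT); rewrite size_map size_iota ltnn.
by case/allPn=> _ /mapP[k _ ->] rk; exists k.
Qed.

(* Kronecker substitution x_i := x ^ (N ^ i). *)
Lemma mpoly_nonvanishing n (p : {mpoly K[n]}) :
  p != 0 -> exists v, p.@[v] != 0.
Proof.
move=> p0; pose N := msize p.
pose e (m : 'X_{1..n}) := (\sum_i m i * N ^ i)%N.
have mN m : m \in msupp p -> forall i, (m i < N)%N.
  move=> /msize_mdeg_lt mp i; apply: leq_ltn_trans mp.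
  by rewrite mdegE (bigD1 i) //= leq_addr.
have eI m1 m2 : m1 \in msupp p -> m2 \in msupp p -> e m1 = e m2 -> m1 = m2.
  by move=> /mN lt1 /mN lt2 /(base_expansion_inj lt1 lt2) /mnmP.
pose P : {poly K} := \sum_(m <- msupp p) p@_m *: 'X^(e m).
have [m0 m0p] : exists m0, m0 \in msupp p.
  case: (msupp p) (msupp_eq0 p) => [|m s _].
    by rewrite eqxx (negPf p0).
  by exists m; rewrite inE eqxx.
have P0 : P != 0.
  apply/eqP => /(congr1 (fun q : {poly K} => q`_(e m0))).
  rewrite coef0 coef_sum (bigD1_seq m0) //= coefZ coefXn eqxx mulr1.
  rewrite big_seq_cond big1 ?addr0 => [/eqP|m /andP[mp mm0]].
    by rewrite mcoeff_eq0 m0p.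
  rewrite coefZ coefXn; case: eqP => [/(eI _ _ m0p mp) m0m|]; last first.
    by rewrite mulr0.
  by rewrite m0m eqxx in mm0.
have [k] := poly_nonroot P0 (@mulrIn _ 1 (oner_neq0 K)).
rewrite /root; set x := k%:R => Px; exists (fun i => x ^+ (N ^ i)).
apply: contraNneq Px => <-; rewrite mevalE /P horner_sum; apply/eqP.
apply: eq_bigr => m _; rewrite hornerZ hornerXn /e -prodrXr; congr (_ * _).
by apply: eq_bigr => i _; rewrite -exprM mulnC.
Qed.

(** The bound on the size is what lets root counting on a line stand in for Bezout's theorem
    below. *)
Lemma mpoly_line_poly n (p : {mpoly K[n]}) (v w : 'I_n -> K) :
  exists2 P : {poly K}, (size P <= msize p)%N &
    forall t, P.[t] = p.@[fun i => v i + w i * t].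
Proof.
exists (\sum_(m <- msupp p)
   p@_m *: \prod_i ((v i)%:P + (w i)%:P * 'X) ^+ m i) => [|t]; last first.
  rewrite horner_sum mevalE; apply: eq_bigr => m _.
  rewrite hornerZ horner_prod; congr (_ * _); apply: eq_bigr => i _.
  by rewrite !hornerE.
have szM (P Q : {poly K}) a b : (size P <= a.+1)%N -> (size Q <= b.+1)%N ->
    (size (P * Q)%R <= (a + b).+1)%N.
  move=> Pa Qb; apply: leq_trans (size_polyMleq P Q) _.
  by rewrite -subn1 leq_subLR add1n -addnS -addSn leq_add.
apply: leq_trans (size_sum _ _ _) _; apply/bigmax_leqP_seq => m mp _.
apply: leq_trans (size_scale_leq _ _) _; apply: leq_trans (msize_mdeg_lt mp).
rewrite mdegE; apply: (big_ind2 (fun (P : {poly K}) k => size P <= k.+1)%N).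
- by rewrite size_poly1.
- by move=> P a Q b; apply: szM.
move=> i _; elim: (m i) => [|k IH]; first by rewrite expr0 size_poly1.
rewrite exprS -[k.+1]add1n; apply: szM => //.
apply: leq_trans (size_polyD _ _) _; rewrite geq_max.
rewrite (leq_trans (size_polyC_leq1 _)) //=.
by apply: leq_trans (size_polyMleq _ _) _; rewrite size_polyX addn2 /= ltnS size_polyC_leq1.
Qed.

(** On the line from v to a point u where p does not vanish, p restricts to a nonzero polynomial in
    one variable, which has finitely many roots. *)
Lemma mpoly_nonvanishing_near n (p : {mpoly K[n]}) (v : 'I_n -> K) (d : K) :
  p != 0 -> 0 < d ->
  exists2 w, (forall i, `|w i - v i| <= d) & p.@[w] != 0.
Proof.
move=> /mpoly_nonvanishing[u pu] d0.
have [P _ PE] := mpoly_line_poly p v (fun i => u i - v i).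
have P0 : P != 0.
  apply: contraNneq pu => P0; rewrite -(horner0 (1 : K)) -P0 PE; apply/eqP.
  by apply: meval_eq => i /=; rewrite mulr1 subrKC.
pose B : K := \sum_i `|u i - v i|; have B0 : 0 <= B by apply: sumr_ge0.
have B1 : 0 < B + 1 by rewrite ltr_wpDl.
(* Infinitely many parameters, all small enough to stay within d of v; the added 1 keeps the
   denominator positive when u = v. *)
pose f (k : nat) : K := d / (B + 1) / k.+1%:R.
have fI : injective f.
  have c0 : d / (B + 1) != 0 by rewrite mulf_neq0 ?invr_eq0 ?gt_eqF.
  by move=> i j /(mulfI c0)/invr_inj/eqP; rewrite eqr_nat eqSS => /eqP.
have [k] := poly_nonroot P0 fI; rewrite /root PE => pk.
exists (fun i => v i + (u i - v i) * f k) => // i.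
rewrite addrC addKr normrM; apply: (@le_trans _ _ ((B + 1) * (d / (B + 1)))).
  apply: ler_pM => //.
    rewrite /B (bigD1 i) //= -addrA lerDl addr_ge0 ?sumr_ge0 //.
  have c0 : 0 <= d / (B + 1) by rewrite divr_ge0 ?(ltW d0) ?(ltW B1).
  have fk0 : 0 <= f k by rewrite /f divr_ge0.
  by rewrite ger0_norm // /f ler_pdivrMr ?ltr0n // ler_peMr // ler1n.
by rewrite mulrC divfK // gt_eqF.
Qed.

(** Open sets of projective space are defined by forms, but quantifier elimination yields an
    arbitrary polynomial; this lemma and the next pass between the two. *)
Lemma pihomog_nonvanishing n (p : {mpoly K[n]}) (v : 'I_n -> K) :
  p.@[v] != 0 -> exists d, (pihomog mdeg d p).@[v] != 0.
Proof.
move=> pv; have [/hasP[d _ dP]|/hasPn no] :=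
  boolP (has (fun d => (pihomog mdeg d p).@[v] != 0) (iota 0 (msize p))).
  by exists d.
case/eqP: pv; rewrite (pihomog_partitionE (leqnn (msize p))) raddf_sum big1 //.
move=> i _; apply/eqP/negbNE/no.
by rewrite mem_iota /= add0n.
Qed.

(* The monomials of degree d contribute t ^+ d, so the coefficient of degree d *)
(* of the polynomial function t |-> p (t v) is the value of the degree d part. *)
Lemma pihomog_nonvanishing_scale n (p : {mpoly K[n]}) d (v : 'I_n -> K) :
  (pihomog mdeg d p).@[v] != 0 -> exists2 t, t != 0 & p.@[fun i => t * v i] != 0.
Proof.
move=> pdv; pose N := maxn (msize p) d.+1.
have dN : (d < N)%N by rewrite leq_max leqnn orbT.
pose P : {poly K} := \sum_(e < N) ((pihomog mdeg e p).@[v])%:P * 'X^e.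
pose f (k : nat) : K := k.+1%:R.
have fI : injective f by move=> i j /eqP; rewrite eqr_nat eqSS => /eqP.
have PE t : P.[t] = p.@[fun i => t * v i].
  rewrite [in RHS](pihomog_partitionE (leq_maxl _ d.+1 : msize p <= N)%N) raddf_sum.
  rewrite horner_sum; apply: eq_bigr => e _; rewrite !hornerE.
  have /dhomogP hom := pihomogP mdeg e p.
  rewrite !mevalE mulr_suml; apply: eq_big_seq => m /hom em.
  have {em}-> : e = (\sum_i m i)%N :> nat by rewrite -mdegE -em.
  rewrite -mulrA; congr (_ * _); rewrite -prodrXr mulrC -big_split /=.
  by apply: eq_bigr => i _; rewrite exprMn.
have P0 : P != 0.
  apply/eqP => /(congr1 (fun q : {poly K} => q`_d)); rewrite coef0 coef_sum.
  rewrite (bigD1 (Ordinal dN)) //= coefCM coefXn eqxx mulr1 big1 ?addr0.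
    by apply/eqP.
  by move=> e; rewrite -val_eqE eq_sym coefCM coefXn => /negPf /= ->; rewrite mulr0.
have [k] := poly_nonroot P0 fI.
by rewrite /root PE => pk; exists (f k) => //; rewrite pnatr_eq0.
Qed.
End Nonvanishing.

(** * Lines and heptagons *)

Lemma ord3_1D1 : 1 + 1 = -1 :> 'I_3. Proof. exact: val_inj. Qed.

Lemma ord3_N1B1 : -1 - 1 = 1 :> 'I_3. Proof. exact: val_inj. Qed.

Section CrossProduct.

Variable K : comNzRingType.
Implicit Types u v w : 'I_3 -> K.

Definition dot u v : K := \sum_i u i * v i.

(* The indices are read modulo 3, so that -1 stands for 2. *)
Definition cross u v : 'I_3 -> K :=
  fun i => u (i + 1) * v (i - 1) - u (i - 1) * v (i + 1).

Lemma ord3E (P : 'I_3 -> Prop) : P 0 -> P 1 -> P (-1) -> forall i, P i.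
Proof.
move=> P0 P1 P2 [[|[|[|//]]] p].
- by rewrite (_ : Ordinal p = 0) //; apply: val_inj.
- by rewrite (_ : Ordinal p = 1) //; apply: val_inj.
- by rewrite (_ : Ordinal p = -1) //; apply: val_inj.
Qed.

Lemma sum3E (F : 'I_3 -> K) : \sum_i F i = F 0 + F 1 + F (-1).
Proof.
rewrite !big_ord_recr big_ord0 /= add0r.
by congr (F _ + F _ + F _); apply: val_inj.
Qed.

Lemma dotE u v : dot u v = u 0 * v 0 + u 1 * v 1 + u (-1) * v (-1).
Proof. exact: sum3E. Qed.

Lemma crossE u v :
  [/\ cross u v 0 = u 1 * v (-1) - u (-1) * v 1,
      cross u v 1 = u (-1) * v 0 - u 0 * v (-1)
    & cross u v (-1) = u 0 * v 1 - u 1 * v 0].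
Proof.
by rewrite /cross ord3_1D1 ord3_N1B1 add0r sub0r subrr addNr.
Qed.

Definition cross0 u v := let: And3 e _ _ := crossE u v in e.
Definition cross1 u v := let: And3 _ e _ := crossE u v in e.
Definition cross2 u v := let: And3 _ _ e := crossE u v in e.

Lemma dot_crossl u v : dot (cross u v) u = 0.
Proof. by rewrite dotE cross0 cross1 cross2; ring. Qed.

Lemma dot_crossr u v : dot (cross u v) v = 0.
Proof. by rewrite dotE cross0 cross1 cross2; ring. Qed.

Lemma dotC u v : dot u v = dot v u.
Proof. by apply: eq_bigr => i _; rewrite mulrC. Qed.

Lemma det_rot u v w : dot (cross u v) w = dot (cross v w) u.
Proof. by rewrite !dotE !cross0 !cross1 !cross2; ring. Qed.

Lemma det_swap u v w : dot (cross u v) w = - dot (cross v u) w.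
Proof. by rewrite !dotE !cross0 !cross1 !cross2; ring. Qed.

(** Cramer's rule: up to the determinant, the three cross products form the basis dual to u, v,
    w. *)
Lemma det_scale u v w x i :
  dot (cross u v) w * x i =
    dot x u * cross v w i + dot x v * cross w u i + dot x w * cross u v i.
Proof.
move: i; apply: ord3E; rewrite ?dotE ?cross0 ?cross1 ?cross2; ring.
Qed.

(** The coordinates of the triple product x × (u × v) = (x·v) u - (x·u) v, indexed by pairs i, j. *)
Lemma cross_cross x u v i j :
  x i * cross u v j - x j * cross u v i =
  (if i == j then 0 else if j == i + 1 then
     (dot x v * u (i - 1) - dot x u * v (i - 1)) else
     (dot x u * v (i + 1) - dot x v * u (i + 1))).
Proof.
move: i; apply: ord3E; move: j; apply: ord3E => /=;
  rewrite ?ord3_1D1 ?ord3_N1B1 ?add0r ?sub0r ?subrr ?addNr ?dotE ?cross0 ?cross1 ?cross2; ring.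
Qed.

End CrossProduct.

Section Lines.

Variable K : fieldType.
Implicit Types (l m : 'I_3 -> K) (v : 'rV[K]_3).

Definition line l : {vspace 'rV[K]_3} := lker (linfun (mulmxr (\col_i l i))).

Lemma mem_line l v : (v \in line l) = (dot (v 0) l == 0).
Proof.
rewrite memv_ker lfunE /=; have e : v *m \col_i l i = (dot (v 0) l)%:M.
  apply/matrixP => i j; rewrite !ord1 !mxE eqxx mulr1n.
  by apply: eq_bigr => k _; rewrite !mxE.
rewrite e; apply/eqP/eqP => [/matrixP/(_ 0 0)|->]; last by rewrite raddf0.
by rewrite !mxE eqxx mulr1n.
Qed.

Lemma mem_line_row l w : (\row_i w i \in line l) = (dot w l == 0).
Proof. by rewrite mem_line /dot; under eq_bigr do rewrite mxE. Qed.

Lemma dim_line l i : l i != 0 -> \dim (line l) = 2%N.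
Proof.
move=> li; pose f := linfun (mulmxr (\col_i l i)) : 'Hom('rV[K]_3, 'rV[K]_1).
have := limg_ker_dim f fullv; rewrite capfv dimvf /dim /= -/(line l).
suff -> : \dim (limg f) = 1%N by rewrite addn1 => -[].
apply/eqP; rewrite eqn_leq; apply/andP; split.
  by apply: leq_trans (dimvS (subvf _)) _; rewrite dimvf.
rewrite lt0n dimv_eq0; apply/eqP => /eqP; rewrite -subv0 => /subvP/(_ (f (delta_mx 0 i))).
rewrite memv_img ?memvf // => /(_ isT); rewrite memv0 lfunE /= -rowE => /eqP/matrixP/(_ 0 0).
by rewrite !mxE => /eqP; rewrite (negPf li).
Qed.

(** With e the i-th basis vector, [cross l e] lies on [line l], and its product with m is, up to
    sign, the i-th coordinate of [cross l m]. *)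
Lemma line_neq l m i : cross l m i != 0 -> line l <> line m.
Proof.
move=> ci e; have : \row_k cross l (fun j => (j == i)%:R) k \in line m.
  by rewrite -e mem_line_row dot_crossl.
rewrite mem_line_row det_rot det_rot det_swap oppr_eq0.
rewrite /dot (bigD1 i) //= eqxx mulr1 big1 ?addr0 => [|j /negPf->].
  by rewrite (negPf ci).
by rewrite mulr0.
Qed.

Lemma line_cap3_eq0 l m n : dot (cross l m) n != 0 ->
  \dim (line l :&: line m :&: line n)%VS = 0%N.
Proof.
move=> d0; apply/eqP; rewrite dimv_eq0 -subv0; apply/subvP => v.
rewrite !memv_cap !mem_line => /andP[/andP[/eqP vl /eqP vm] /eqP vn].
rewrite memv0; apply/eqP/rowP => i; rewrite mxE; apply: (mulfI d0).
by rewrite det_scale vl vm vn !mul0r !addr0 mulr0.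
Qed.

Lemma line_cap_cross l m v i : cross l m i != 0 ->
  v \in (line l :&: line m)%VS -> forall j, v 0 j = v 0 i / cross l m i * cross l m j.
Proof.
move=> ci; rewrite memv_cap !mem_line => /andP[/eqP vl /eqP vm] j.
apply: (mulIf ci); rewrite mulrAC divfK //; apply/eqP.
rewrite -subr_eq0 cross_cross vl vm !mul0r subrr.
by case: ifP => // _; case: ifP.
Qed.

End Lines.

Lemma dot_neq0 (K : pzRingType) (u v : 'I_3 -> K) :
  \sum_i u i * v i != 0 -> exists i, u i != 0.
Proof.
move=> uv; apply/existsP; apply: contraNT uv => /existsPn u0.
by rewrite big1 // => i _; move/negPn/eqP: (u0 i) => ->; rewrite mul0r.
Qed.

Lemma meval_dhomogZ (K : comNzRingType) n d (q : {mpoly K[n]}) c (v : 'I_n -> K) :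
  q \is d.-homog -> q.@[fun i => c * v i] = c ^+ d * q.@[v].
Proof.
move=> /dhomogP hq; rewrite !mevalE mulr_sumr; apply: eq_big_seq => m /hq em.
have -> : d = (\sum_i m i)%N by rewrite -mdegE -em.
rewrite mulrCA; congr (_ * _); rewrite -prodrXr -big_split /=.
by apply: eq_bigr => i _; rewrite exprMn.
Qed.

(** * Uniqueness of the adjoint quartic *)

Section Quartics.

Variable K : numFieldType.
Variable L : 'I_7 -> 'I_3 -> K.
Hypothesis genL : forall i j k, i != j -> i != k -> j != k ->
  dot (cross (L i) (L j)) (L k) != 0.
Implicit Types (q : {mpoly K[3]}) (u v : 'I_3 -> K).

Lemma third_index (i j : 'I_7) : exists2 k, k != i & k != j.
Proof.
have : (0 < #|~: [set i; j]|)%N.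
  by rewrite cardsCs setCK card_ord cards2; case: eqP.
by case/card_gt0P => k; rewrite !inE negb_or => /andP[ki kj]; exists k.
Qed.

Lemma cross_neq0 i j : i != j -> exists k, cross (L i) (L j) k != 0.
Proof.
move=> ij; have [k ki kj] := third_index i j.
by apply: (@dot_neq0 _ _ (L k)); apply: genL; rewrite // eq_sym.
Qed.

Lemma dhomog_msize_le d q : q \is d.-homog -> (msize q <= d.+1)%N.
Proof. by move=> /dhomogP hq; rewrite msizeE; apply/bigmax_leqP_seq => m /hq <-. Qed.

(** Along v + t u the form has degree at most 4 in t and vanishes where this line meets each L_j.
    The inequality of products says, with denominators cleared, that these parameters t are
    distinct. *)
Lemma quartic_five_roots q u v (J : seq 'I_7) : q \is 4.-homog ->
  uniq J -> (4 < size J)%N -> {in J, forall j, dot u (L j) != 0} ->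
  {in J &, forall i j, i != j ->
     dot v (L i) * dot u (L j) != dot v (L j) * dot u (L i)} ->
  {in J, forall j,
     q.@[fun k => v k + u k * - (dot v (L j) / dot u (L j))] = 0} ->
  q.@[v] = 0.
Proof.
move=> hq uJ szJ uJ0 dJ qJ; have [P szP PE] := mpoly_line_poly q v u.
have -> : q.@[v] = P.[0].
  by rewrite PE; apply: meval_eq => k; rewrite mulr0 addr0.
suff -> : P = 0 by rewrite horner0.
apply: contraTeq szJ => P0; rewrite -leqNgt -ltnS.
apply: leq_trans (leq_trans szP (dhomog_msize_le hq)).
rewrite -(size_map (fun j => - (dot v (L j) / dot u (L j)))).
apply: max_poly_roots => //.
  by apply/allP => _ /mapP[j jJ ->]; rewrite /root PE qJ.
rewrite map_inj_in_uniq // => i j iJ jJ /oppr_inj e; apply/eqP.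
apply: contraTT isT => ij; have := dJ i j iJ jJ ij.
by rewrite -eqr_div ?uJ0 // e eqxx.
Qed.

(* Five known zeros on the line: its meets with all L_j but L_j0. *)
Lemma quartic_vanishing_on_line q i0 j0 : q \is 4.-homog -> i0 != j0 ->
  (forall j, j != i0 -> j != j0 -> q.@[cross (L i0) (L j)] = 0) ->
  forall v, dot v (L i0) = 0 -> q.@[v] = 0.
Proof.
move=> hq ij0 q0; pose u := cross (L i0) (L j0).
have ui0 : dot u (L i0) = 0 by rewrite dot_crossl.
(* The point u, the meet with L_j0, serves as the point at infinity of the line L_i0. *)
have on_line v : dot v (L i0) = 0 -> dot v (L j0) != 0 -> q.@[v] = 0.
  move=> vi0 vj0; pose J := enum (~: [set i0; j0]).
  have JP j : j \in J -> j != i0 /\ j != j0.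
    by rewrite mem_enum !inE negb_or => /andP[].
  have uJ j : j \in J -> dot u (L j) != 0.
    by move=> /JP[ji jj]; apply: genL; rewrite // eq_sym.
  apply: (@quartic_five_roots q u v J) => //; first exact: enum_uniq.
  - by rewrite -cardE cardsCs setCK card_ord cards2 ij0.
  - move=> i j iJ jJ ij; have [ii0 _] := JP i iJ; have [ji0 _] := JP j jJ.
    apply: contraNneq vj0 => e.
    (* If the parameters of L_i and L_j agreed, w would be orthogonal to the independent L_i0, L_i
       and L_j, hence zero, which would put v on L_j0. *)
    pose w k := dot u (L i) * v k - dot v (L i) * u k.
    have dw x : dot w x = dot u (L i) * dot v x - dot v (L i) * dot u x.
      by rewrite (dotE w) (dotE v x) (dotE u x) /w; ring.
    have w0 k : w k = 0.
      have d0 : dot (cross (L i0) (L i)) (L j) != 0.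
        by apply: genL; rewrite // eq_sym.
      apply: (mulfI d0); rewrite det_scale !dw ui0 vi0 e.
      ring.
    have := dw (L j0); rewrite {2}/u dot_crossr mulr0 subr0.
    rewrite {1}/dot big1 => [|k _]; last by rewrite w0 mul0r.
    by move/esym/eqP; rewrite mulf_eq0 (negPf (uJ i iJ)).
  - move=> j jJ; have [ji jj] := JP j jJ.
    pose w k := v k + u k * - (dot v (L j) / dot u (L j)).
    have dw x : dot w x = dot v x - dot v (L j) / dot u (L j) * dot u x.
      by rewrite (dotE w) (dotE v x) (dotE u x) /w; ring.
    have [k ck] : exists k, cross (L i0) (L j) k != 0.
      by apply: cross_neq0; rewrite eq_sym.
    have wE := @line_cap_cross _ (L i0) (L j) (\row_k w k) k ck.
    rewrite (meval_eq (v2 := fun m => w k / cross (L i0) (L j) k * cross (L i0) (L j) m)).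
      by rewrite (meval_dhomogZ _ _ hq) q0 ?mulr0.
    move=> m; rewrite -/(w m).
    have := wE _ m; rewrite !mxE; apply.
    rewrite memv_cap !mem_line_row !dw vi0 ui0 mulr0 subrr eqxx /=.
    by rewrite divfK ?uJ // subrr.
have [j1 j1i j1j] := third_index i0 j0; pose w := cross (L i0) (L j1).
have wj0 : dot w (L j0) != 0 by apply: genL; rewrite // eq_sym.
(* The points u + (k + 1) w of L_i0 are off L_j0, so q restricted to this parametrisation has
   infinitely many roots and vanishes at 0 as well. *)
have qu : q.@[u] = 0.
  have [P _ PE] := mpoly_line_poly q u w.
  have -> : q.@[u] = P.[0].
    by rewrite PE; apply: meval_eq => k; rewrite mulr0 addr0.
  suff -> : P = 0 by rewrite horner0.
  apply/eqP; apply: contraT => P0.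
  have SI : injective (fun k : nat => k.+1%:R : K).
    by move=> a b /eqP; rewrite eqr_nat eqSS => /eqP.
  have [k] := poly_nonroot P0 SI; rewrite /root PE.
  have dt x : dot (fun i => u i + w i * k.+1%:R) x = dot u x + dot w x * k.+1%:R.
    by rewrite !dotE; ring.
  rewrite on_line ?eqxx // dt ?ui0 ?dot_crossl ?dot_crossr ?mul0r ?addr0 //.
  by rewrite add0r mulf_neq0 // pnatr_eq0.
move=> v vi0; have [vj0|] := eqVneq (dot v (L j0)) 0; last exact: on_line.
have [k ck] := cross_neq0 ij0.
rewrite (meval_eq (v2 := fun m => v k / u k * u m)); last first.
  move=> m; have := @line_cap_cross _ (L i0) (L j0) (\row_i v i) k ck _ m.
  by rewrite !mxE; apply; rewrite memv_cap !mem_line_row vi0 vj0 eqxx.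
by rewrite (meval_dhomogZ _ _ hq) qu mulr0.
Qed.

(** A general line through a point where q does not vanish meets six of the lines in distinct
    points, too many roots for a quartic. *)
Lemma quartic_vanishing_on_lines q : q \is 4.-homog ->
  (forall i v, dot v (L i) = 0 -> q.@[v] = 0) -> q = 0.
Proof.
move=> hq qL; apply/eqP; apply: contraT => /mpoly_nonvanishing[v qv].
have vL i : dot v (L i) != 0 by apply: contraNneq qv => /qL->.
pose ell i : {mpoly K[3]} := \sum_k L i k *: 'X_k.
have ellE i u : (ell i).@[u] = dot u (L i).
  rewrite /ell raddf_sum /dot; apply: eq_bigr => k _.
  by rewrite /= mevalZ mevalXU mulrC.
pose p i j := dot v (L i) *: ell j - dot v (L j) *: ell i.
have pE i j u : (p i j).@[u] = dot v (L i) * dot u (L j) - dot v (L j) * dot u (L i).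
  by rewrite mevalB !mevalZ !ellE.
pose D := (\prod_(i | i != 0) ell i) *
  \prod_(i | i != 0) \prod_(j | (j != 0) && (i != j)) p i j.
have D0 : D != 0.
  have nz (r : {mpoly K[3]}) u : r.@[u] != 0 -> r != 0.
    by apply: contraNneq => ->; rewrite meval0.
  rewrite mulf_neq0 //; first apply/prodf_neq0 => i i0.
    by apply: (@nz _ v); rewrite ellE.
  apply/prodf_neq0 => i i0; apply/prodf_neq0 => j /andP[j0 ij].
  apply: (@nz _ (cross (L i) (L 0))); rewrite pE dot_crossl mulr0 subr0.
  by rewrite mulf_neq0 // genL // eq_sym.
have [u] := mpoly_nonvanishing D0.
rewrite mevalM mulf_eq0 negb_or !rmorph_prod /= => /andP[/prodf_neq0 uL /prodf_neq0 uD].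
have JP j : j \in enum [set~ (0 : 'I_7)] -> j != 0 by rewrite mem_enum !inE.
apply/negPn/negP => _; case/eqP: qv.
apply: (@quartic_five_roots q u v (enum [set~ (0 : 'I_7)])) => //.
- exact: enum_uniq.
- by rewrite -cardE cardsC1 card_ord.
- by move=> j /JP/uL; rewrite ellE.
- move=> i j /JP/uD; rewrite rmorph_prod => /prodf_neq0 ui /JP j0 ij.
  by have := ui j; rewrite j0 ij => /(_ isT); rewrite /= pE subr_eq0.
move=> j /JP/uL; rewrite ellE => uj; apply: (qL j).
rewrite (_ : dot _ _ = dot v (L j) - dot v (L j) / dot u (L j) * dot u (L j)).
  by rewrite divfK // subrr.
rewrite !dotE; ring.
Qed.

Definition adjacent (i j : 'I_7) := (j == i + 1) || (i == j + 1).

(* Along the lines 0, 1, 2, ... in turn, the four residual points and the      *)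
(* vertex on the preceding line are five zeros.                               *)
Lemma quartic_vanishing q : q \is 4.-homog ->
  (forall i j, i != j -> ~~ adjacent i j -> q.@[cross (L i) (L j)] = 0) ->
  q.@[cross (L 0) (L 1)] = 0 -> q = 0.
Proof.
move=> hq qres q01; apply: (quartic_vanishing_on_lines hq).
suff onL k : forall v, dot v (L k%:R) = 0 -> q.@[v] = 0.
  by move=> i v; rewrite -(natr_Zp i); apply: onL.
elim: k => [|k IH].
  apply: (@quartic_vanishing_on_line q 0 (-1) hq) => // j j0 jm.
  have [->//|j1] := eqVneq j 1; apply: qres; first by rewrite eq_sym.
  rewrite /adjacent add0r negb_or j1 eq_sym.
  by rewrite -subr_eq0 opprK in jm.
apply: (@quartic_vanishing_on_line q k.+1%:R k.+2%:R hq).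
  by rewrite -[k.+2]addn1 natrD eq_sym addrC -subr_eq0 addrK.
move=> j j1 j2; have [->|jk] := eqVneq j k%:R.
  by apply: IH; rewrite dot_crossr.
apply: qres; first by rewrite eq_sym.
rewrite /adjacent negb_or; apply/andP; split.
  by apply: contra_neq j2 => ->; rewrite -[k.+2]addn1 natrD.
apply: contra_neq jk => e; apply: (addIr 1).
by rewrite -e -[k.+1]addn1 natrD.
Qed.

Lemma heptagon_lines : heptagon (fun i => line (L i)).
Proof.
split=> [i|i j ij|i j k ij ik jk]; last exact/line_cap3_eq0/genL.
  have [j ji _] := third_index i i; have [k ki kj] := third_index i j.
  have : dot (L i) (cross (L j) (L k)) != 0.
    by rewrite dotC -det_rot genL // eq_sym.
  by case/dot_neq0 => a; apply: dim_line.
by have [k ck] := cross_neq0 ij; apply: line_neq ck.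
Qed.

Lemma adjoint_curve_lines q : quartic q ->
  (forall i j, i != j -> ~~ adjacent i j -> q.@[cross (L i) (L j)] = 0) ->
  adjoint_curve (fun i => line (L i)) q.
Proof.
move=> [q0 hq] qres.
split=> [//|P [[i [j [ij ->]]] nv] v vP|q' [_ hq'] q'res].
  have nadj : ~~ adjacent i j.
    apply/negP => /orP[/eqP e|/eqP e]; first by apply: (nv i); rewrite /vertex e.
    by apply: (nv j); rewrite /vertex e capvC.
  have [k ck] := cross_neq0 ij.
  have vE := line_cap_cross ck vP.
  rewrite (meval_eq q vE) (meval_dhomogZ _ _ hq) qres // ?mulr0 //.
have q'c i j : i != j -> ~~ adjacent i j -> q'.@[cross (L i) (L j)] = 0.
  move=> ij nadj.
  rewrite (meval_eq (v2 := fun k => (\row_k cross (L i) (L j) k) 0 k)).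
    apply: (q'res (line (L i) :&: line (L j))%VS); last first.
      by rewrite memv_cap !mem_line_row dot_crossl dot_crossr eqxx.
    (* Were this point the vertex k, lines k and k + 1 would both pass through the meet of i and j;
       general position makes them i and j, which are not adjacent. *)
    split=> [|k eP]; first by exists i, j.
    have on_k : \row_m cross (L i) (L j) m \in vertex (fun i => line (L i)) k.
      by rewrite -eP memv_cap !mem_line_row dot_crossl dot_crossr eqxx.
    move: on_k; rewrite /vertex memv_cap !mem_line_row => /andP[k0 k1].
    have inij m : dot (cross (L i) (L j)) (L m) == 0 -> (m == i) || (m == j).
      apply: contraTT; rewrite negb_or => /andP[mi mj].
      by apply: genL; rewrite // eq_sym.
    have kk : k + 1 != k by rewrite -subr_eq0 addrAC subrr add0r.
    move: nadj kk; rewrite /adjacent negb_or => /andP[n1 n2].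
    case/orP: (inij _ k0) (inij _ k1) => /eqP-> /orP[] /eqP e; rewrite e ?eqxx //.
      by rewrite e eqxx in n1.
    by rewrite e eqxx in n2.
  by move=> k; rewrite mxE.
pose c := q'.@[cross (L 0) (L 1)] / q.@[cross (L 0) (L 1)].
have qW : q.@[cross (L 0) (L 1)] != 0.
  by apply: contraNneq q0 => /(quartic_vanishing hq qres)->.
exists c; apply/eqP; rewrite -subr_eq0; apply/eqP; apply: quartic_vanishing.
- by rewrite rpredB // dhomogZ.
- by move=> i j ij nadj; rewrite mevalB mevalZ qres // q'c // mulr0 subr0.
- by rewrite mevalB mevalZ divfK // subrr.
Qed.

End Quartics.

(** * Quantifier elimination *)

Section Definable.

Variable K : closedFieldType.
Implicit Types (e : seq K) (P Q : seq K -> Prop) (f g : seq K -> K).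

Definition polyfun f := exists t : GRing.term K, forall e, GRing.eval e t = f e.

Definition definable P :=
  exists F : GRing.formula K, forall e, GRing.holds e F <-> P e.

Lemma polyfun_nth i : polyfun (fun e => nth 0 e i).
Proof. by exists (GRing.Var K i). Qed.

Lemma polyfunM f g : polyfun f -> polyfun g -> polyfun (fun e => f e * g e).
Proof.
by move=> [t tE] [u uE]; exists (GRing.Mul t u) => e /=; rewrite tE uE.
Qed.

Lemma polyfunB f g : polyfun f -> polyfun g -> polyfun (fun e => f e - g e).
Proof.
move=> [t tE] [u uE]; exists (GRing.Add t (GRing.Opp u)) => e /=.
by rewrite tE uE.
Qed.

Lemma polyfunX f n : polyfun f -> polyfun (fun e => f e ^+ n).
Proof. by move=> [t tE]; exists (GRing.Exp t n) => e /=; rewrite tE. Qed.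

Lemma polyfun_sum I (s : seq I) (F : I -> seq K -> K) :
  (forall i, polyfun (F i)) -> polyfun (fun e => \sum_(i <- s) F i e).
Proof.
move=> FP; elim: s => [|i s [t tE]].
  by exists (GRing.Const 0) => e; rewrite big_nil.
have [u uE] := FP i.
by exists (GRing.Add u t) => e /=; rewrite big_cons tE uE.
Qed.

Lemma polyfun_prod I (s : seq I) (F : I -> seq K -> K) :
  (forall i, polyfun (F i)) -> polyfun (fun e => \prod_(i <- s) F i e).
Proof.
move=> FP; elim: s => [|i s [t tE]].
  by exists (GRing.Const 1) => e; rewrite big_nil.
have [u uE] := FP i.
by exists (GRing.Mul u t) => e /=; rewrite big_cons tE uE.
Qed.

Lemma definable_eq0 f : polyfun f -> definable (fun e => f e = 0).
Proof.
by move=> [t tE]; exists (GRing.Equal t (GRing.Const 0)) => e /=; rewrite tE.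
Qed.

Lemma definable_not P : definable P -> definable (fun e => ~ P e).
Proof.
by move=> [F FP]; exists (GRing.Not F) => e /=; rewrite FP.
Qed.

Lemma definable_and P Q :
  definable P -> definable Q -> definable (fun e => P e /\ Q e).
Proof.
by move=> [F FP] [G GP]; exists (GRing.And F G) => e /=; rewrite FP GP.
Qed.

Lemma definable_neq0 f : polyfun f -> definable (fun e => f e != 0).
Proof.
move=> /definable_eq0/definable_not [F FP]; exists F => e; rewrite FP.
by split=> [?|/eqP //]; apply/eqP.
Qed.

Lemma definable_all (I : finType) (P : I -> seq K -> Prop) :
  (forall i, definable (P i)) -> definable (fun e => forall i, P i e).
Proof.
move=> dP.
have [F FP] : definable (fun e => forall i, i \in enum I -> P i e).
  elim: (enum I) => [|i s [G GP]]; first by exists (GRing.Bool true).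
  have [F FP] := dP i; exists (GRing.And F G) => e /=; rewrite FP GP.
  split=> [[Pi Ps] j|Ps]; first by rewrite inE => /predU1P[->|/Ps].
  by split=> [|j js]; apply: Ps; rewrite inE ?eqxx ?js ?orbT.
by exists F => e; rewrite FP; split=> Pe i => [|_]; apply: Pe; rewrite ?mem_enum.
Qed.

Lemma definable_ext P Q : (forall e, P e <-> Q e) -> definable P -> definable Q.
Proof. by move=> PQ [F FP]; exists F => e; rewrite FP. Qed.

Lemma definable_if (b : bool) P :
  definable P -> definable (fun e => b -> P e).
Proof.
case: b => dP; first by apply: definable_ext dP => e; split=> // Pe; apply: Pe.
by exists (GRing.Bool true) => e.
Qed.

Lemma definable_has (I : finType) (P : I -> seq K -> Prop) :
  (forall i, definable (P i)) -> definable (fun e => exists i, P i e).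
Proof.
move=> dP.
have [F FP] : definable (fun e => exists2 i, i \in enum I & P i e).
  elim: (enum I) => [|i s [G GP]].
    by exists (GRing.Bool false) => e; split=> //= -[].
  have [F FP] := dP i; exists (GRing.Or F G) => e /=; rewrite FP GP; split.
    case=> [Pi|[j js Pj]]; first by exists i; rewrite ?inE ?eqxx.
    by exists j; rewrite ?inE ?js ?orbT.
  by case=> j; rewrite inE => /predU1P[->|js] Pj; [left|right; exists j].
exists F => e; rewrite FP; split=> [[i _ Pi]|[i Pi]]; first by exists i.
by exists i; rewrite ?mem_enum.
Qed.

Lemma definable_ex (I : seq nat) P : definable P ->
  definable (fun e => exists2 e',
    (forall i, i \notin I -> nth 0 e i = nth 0 e' i) & P e').
Proof.
move=> [F FP]; exists (foldr GRing.Exists F I) => e.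
split=> [/GRing.foldExistsP[e' eqe /FP Pe']|[e' eqe /FP Pe']].
  by exists e' => // i iI; apply: eqe; rewrite inE.
by apply/GRing.foldExistsP; exists e' => // i; rewrite inE => /eqe.
Qed.

Fixpoint mpoly_of_term n (t : GRing.term K) : {mpoly K[n]} :=
  match t with
  | GRing.Var i => if insub i is Some j then 'X_j else 0
  | GRing.Const c => c%:MP
  | GRing.NatConst k => k%:R
  | GRing.Add t u => mpoly_of_term n t + mpoly_of_term n u
  | GRing.Opp t => - mpoly_of_term n t
  | GRing.NatMul t k => mpoly_of_term n t *+ k
  | GRing.Mul t u => mpoly_of_term n t * mpoly_of_term n u
  | GRing.Inv _ => 0 (* eliminated terms contain no inverse *)
  | GRing.Exp t k => mpoly_of_term n t ^+ k
  end.

Lemma eval_mpoly_of_term n (v : 'I_n -> K) (t : GRing.term K) :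
  GRing.rterm t ->
  GRing.eval [seq v i | i <- enum 'I_n] t = (mpoly_of_term n t).@[v].
Proof.
elim: t => //=.
(* A variable of index at least n reads the default 0 of [nth], which is also its image under
   [mpoly_of_term]. *)
- move=> i _; case: insubP => [j _ <-|iP].
    rewrite mevalXU (nth_map j) ?size_enum_ord ?ltn_ord //.
    congr v; exact: nth_ord_enum.
  by rewrite meval0 nth_default // size_map size_enum_ord leqNgt.
- by move=> c _; rewrite mevalC.
- by move=> k _; rewrite rmorph_nat.
- by move=> t IHt u IHu /andP[/IHt-> /IHu->]; rewrite mevalD.
- by move=> t IHt /IHt->; rewrite mevalN.
- by move=> t IHt k /IHt->; rewrite mevalMn.
- by move=> t IHt u IHu /andP[/IHt-> /IHu->]; rewrite mevalM.
- by move=> t IHt k /IHt->; rewrite rmorphXn.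
Qed.

(* Quantifier elimination makes a first-order condition a Boolean combination *)
(* of polynomial equations, so it has a constant truth value off some         *)
(* hypersurface.                                                              *)
Lemma definable_generic n P : definable P ->
  exists (b : bool) (G : {mpoly K[n]}), G != 0 /\
    forall v : 'I_n -> K, G.@[v] != 0 ->
      (P [seq v i | i <- enum 'I_n] <-> b).
Proof.
move=> [F FP].
pose proj := @ClosedFieldQE.ex_elim K.
pose Q := GRing.quantifier_elim proj (GRing.to_rform F).
have wfp : GRing.wf_QE_proj proj := @ClosedFieldQE.wf_ex_elim K.
have okp : GRing.valid_QE_proj proj.
  exact: ClosedFieldQE.holds_ex_elim (@solve_monicpoly K).
have QP e : P e <-> GRing.qf_eval e Q.
  rewrite -FP; have qP := GRing.quantifier_elim_rformP wfp okp e
    (GRing.to_rform_rformula F).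
  by split=> [/GRing.to_rformP/qP //|/qP/GRing.to_rformP].
have := GRing.quantifier_elim_wf wfp (GRing.to_rform_rformula F).
rewrite -/Q; case/andP=> qfQ rQ.
suff [b [G [G0 GP]]] : exists b G, G != 0 /\ forall v : 'I_n -> K,
    G.@[v] != 0 -> GRing.qf_eval [seq v i | i <- enum 'I_n] Q = b.
  by exists b, G; split=> // v /GP <-.
elim: Q qfQ rQ {QP} => //=.
- by move=> b _ _; exists b, 1; rewrite oner_neq0.
- move=> t u _ /andP[rt ru]; pose G := mpoly_of_term n t - mpoly_of_term n u.
  have GE v : (GRing.eval [seq v i | i <- enum 'I_n] t ==
      GRing.eval [seq v i | i <- enum 'I_n] u) = (G.@[v] == 0).
    by rewrite !eval_mpoly_of_term // mevalB subr_eq0.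
  (* An equation is either an identity, true everywhere, or false off its own zero locus. *)
  have [G0|GN0] := eqVneq G 0.
    exists true, 1; rewrite oner_neq0; split=> // v _.
    by rewrite GE G0 meval0 eqxx.
  by exists false, G; split=> // v /negPf Gv; rewrite GE.
- move=> f IHf g IHg /andP[qf qg] /andP[rf rg].
  have [b [F1 [F0 F1P]]] := IHf qf rf; have [c [G [G0 GP]]] := IHg qg rg.
  exists (b && c), (F1 * G); rewrite mulf_neq0 //; split=> // v.
  by rewrite mevalM mulf_eq0 negb_or => /andP[/F1P-> /GP->].
- move=> f IHf g IHg /andP[qf qg] /andP[rf rg].
  have [b [F1 [F0 F1P]]] := IHf qf rf; have [c [G [G0 GP]]] := IHg qg rg.
  exists (b || c), (F1 * G); rewrite mulf_neq0 //; split=> // v.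
  by rewrite mevalM mulf_eq0 negb_or => /andP[/F1P-> /GP->].
- move=> f IHf g IHg /andP[qf qg] /andP[rf rg].
  have [b [F1 [F0 F1P]]] := IHf qf rf; have [c [G [G0 GP]]] := IHg qg rg.
  exists (b ==> c), (F1 * G); rewrite mulf_neq0 //; split=> // v.
  by rewrite mevalM mulf_eq0 negb_or => /andP[/F1P-> /GP->].
- move=> f IHf qf rf; have [b [G [G0 GP]]] := IHf qf rf.
  by exists (~~ b), G; split=> // v /GP->.
Qed.

End Definable.

(** * Newton iteration *)

Section Newton.

Variable R : realType.
Notation C := R[i].

Notation h n := (2^-1 ^+ n).

Lemma half_ge0 n : 0 <= h n :> R.
Proof. by rewrite exprn_ge0 // invr_ge0. Qed.

Lemma le_geometric (a b c : R) : (forall n, a <= b + c * h n) -> a <= b.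
Proof.
move=> le_n; rewrite leNgt; apply/negP => ba.
have d0 : 0 < a - b by rewrite subr_gt0.
have [c0|c0] := lerP c 0.
  by have := le_n 0%N; rewrite expr0 mulr1; lra.
pose n := Num.bound (c / (a - b)).
have := le_n n; rewrite -lerBlDl exprVn ler_pdivlMr ?exprn_gt0 //.
apply/negP; rewrite -ltNge -ltr_pdivrMl // mulrC.
have n1 : c / (a - b) < n%:R by apply: archi_boundP; rewrite divr_ge0 // ltW.
by apply: lt_le_trans n1 _; rewrite -natrX ler_nat ltnW // ltn_expl.
Qed.

(** The intervals of center [a n] and radius c 2^-n are nested; the limit is the supremum of their
    lower ends. *)
Lemma geometric_cauchy_real (a : nat -> R) c :
  (forall n, `|a n.+1 - a n| <= c * h n.+1) ->
  exists l, forall n, `|a n - l| <= c * h n.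
Proof.
move=> ac.
have hS n : c * h n = c * h n.+1 + c * h n.+1.
  by rewrite exprS; field.
have lo : nondecreasing (fun n => a n - c * h n).
  apply/Order.NatMonotonyTheory.nondecnP => n.
  by have := ac n; rewrite ler_norml (hS n) => /andP[]; lra.
have hi i j : (i <= j)%N -> a j + c * h j <= a i + c * h i.
  move: j i; apply: (@Order.NatMonotonyTheory.nonincnP _ _
    (fun n => a n + c * h n)) => n.
  by have := ac n; rewrite ler_norml (hS n) => /andP[]; lra.
have h0 n : 0 <= c * h n.
  by rewrite (hS n) -mulr2n mulrn_wge0 // (le_trans _ (ac n)).
have lohi i j : a i - c * h i <= a j + c * h j.
  have := lo _ _ (leq_maxl i j); have := hi _ _ (leq_maxr i j).
  have := h0 (maxn i j); lra.
pose E := [set x | exists n, x = a n - c * h n]%classic.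
have E0 : (E !=set0)%classic by exists (a 0%N - c * h 0); exists 0%N.
have Eub n : ubound E (a n + c * h n) by move=> _ [k ->].
exists (sup E) => n; rewrite ler_norml; apply/andP; split.
  by have := ge_sup E0 (Eub n); lra.
have /(_ (a n - c * h n)) := @ub_le_sup _ E (ex_intro _ _ (Eub 0%N)).
by have := h0 n; move=> h0n /(_ (ex_intro _ n erefl)); lra.
Qed.

Lemma Re_norm_le (z : C) (c : R) : `|z| <= c%:C -> `|complex.Re z| <= c.
Proof. by move=> zc; rewrite -lecR; apply: le_trans (normc_ge_Re z) zc. Qed.

Lemma norm_le_ReIm (z : C) : `|z| <= (`|complex.Re z| + `|complex.Im z|)%:C.
Proof.
case: z => a b; rewrite normc_def lecR /= -(@ler_pXn2r _ 2) ?nnegrE ?sqrtr_ge0 ?addr_ge0 //.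
rewrite sqr_sqrtr ?addr_ge0 ?sqr_ge0 // sqrrD !real_normK ?num_real //.
by rewrite addrAC lerDl mulrn_wge0 // mulr_ge0.
Qed.

Lemma Im_norm_le (z : C) (c : R) : `|z| <= c%:C -> `|complex.Im z| <= c.
Proof.
move=> zc; rewrite -lecR; apply: le_trans zc; case: z => a b.
rewrite normc_def lecR /= -sqrtr_sqr ler_wsqrtr // lerDr sqr_ge0 //.
Qed.

(** The factor 2 comes from bounding the modulus by the moduli of the real and imaginary parts. *)
Lemma geometric_cauchy (u : nat -> C) (c : R) :
  (forall n, `|u n.+1 - u n| <= (c * h n.+1)%:C) ->
  exists l, forall n, `|u n - l| <= (c * h n *+ 2)%:C.
Proof.
move=> uc.
have [a aP] : exists l, forall n, `|complex.Re (u n) - l| <= c * h n.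
  by apply: geometric_cauchy_real => n; rewrite -raddfB; apply: Re_norm_le.
have [b bP] : exists l, forall n, `|complex.Im (u n) - l| <= c * h n.
  by apply: geometric_cauchy_real => n; rewrite -raddfB; apply: Im_norm_le.
exists (Complex a b) => n; apply: le_trans (norm_le_ReIm _) _.
by rewrite lecR !raddfB /= mulr2n lerD.
Qed.

(** Norms in [C] are elements of [C]; this replaces them by reals, where the order is total. *)
Lemma norm_complexE (z : C) : exists2 a : R, 0 <= a & `|z| = a%:C.
Proof. by exists (complex.Re `|z|); rewrite normc_def // sqrtr_ge0. Qed.

Lemma norm_le_geometric (z : C) (b c : R) :
  (forall n, `|z| <= (b + c * h n)%:C) -> `|z| <= b%:C.
Proof.
have [a _ ->] := norm_complexE z => zb; rewrite lecR.
by apply: (@le_geometric a b c) => n; rewrite -lecR.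
Qed.

Lemma mulmx_row_bound m n (B : 'M[C]_(m, n)) (x : 'cV[C]_n) (k d : R) :
  (forall i, \sum_j `|B i j| <= k%:C) -> (forall j, `|x j 0| <= d%:C) ->
  0 <= d -> forall i, `|(B *m x) i 0| <= (k * d)%:C.
Proof.
move=> Bk xd d0 i; rewrite mxE rmorphM /=.
apply: le_trans (ler_norm_sum _ _ _) _.
apply: (@le_trans _ _ ((\sum_j `|B i j|) * d%:C)); last first.
  by rewrite ler_wpM2r // lecR.
rewrite mulr_suml; apply: ler_sum => j _.
by rewrite normrM ler_wpM2l.
Qed.

(** If A x = 0, then x = (1 - A) x, so any bound on the entries of x can be halved again and
    again. *)
Lemma near_id_unitmx n (A : 'M[C]_n) :
  (forall i, \sum_j `|(1%:M - A) i j| <= (2^-1)%:C) -> A \in unitmx.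
Proof.
move=> A1; rewrite -unitmx_tr -row_free_unit -kermx_eq0.
apply/negPn/negP => /rowV0Pn[v /sub_kermxP vA]; case/negP.
pose x := v^T; have Ax : A *m x = 0.
  by apply: trmx_inj; rewrite trmx_mul trmxK vA trmx0.
have [d d0 xd] : exists2 d : R, 0 <= d & forall j, `|x j 0| <= d%:C.
  have [d d0 dE] := norm_complexE (\sum_j `|x j 0|).
  exists d => // j; rewrite ger0_norm ?sumr_ge0 // in dE.
  by rewrite -dE (bigD1 j) //= lerDl sumr_ge0.
have xk k : forall j, `|x j 0| <= (0 + d * h k)%:C.
  rewrite add0r; elim: k => [|k IH] j; first by rewrite expr0 mulr1.
  have {1}-> : x = (1%:M - A) *m x by rewrite mulmxBl mul1mx Ax subr0.
  rewrite exprS mulrCA; apply: mulmx_row_bound => //.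
  by rewrite mulr_ge0 ?half_ge0.
apply/eqP/rowP => j; rewrite mxE; apply/eqP; rewrite -normr_le0.
have := norm_le_geometric (fun k => xk k j).
by rewrite mxE.
Qed.

Section FixedPoint.

Variables (n : nat) (x0 : 'cV[C]_n) (r : R) (T : 'cV[C]_n -> 'cV[C]_n).

Definition near_center (x : 'cV[C]_n) := forall i, `|x i 0 - x0 i 0| <= r%:C.

Hypothesis T_contracts : forall x y (d : R), near_center x -> near_center y ->
  (forall i, `|x i 0 - y i 0| <= d%:C) ->
  forall i, `|T x i 0 - T y i 0| <= (d / 2)%:C.
Hypothesis T_center : forall i, `|T x0 i 0 - x0 i 0| <= (r / 2)%:C.

(** With a first step of at most r / 2 and the factor 1 / 2, the k-th iterate stays within r (1 -
    2^-k) of the center, so the iteration never leaves the box. *)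
Lemma contraction_fixpoint : 0 <= r -> exists2 x, near_center x & T x = x.
Proof.
move=> r0; pose u k := iter k T x0.
have uP k : (forall i, `|u k i 0 - x0 i 0| <= (r - r * h k)%:C) /\
            (forall i, `|u k.+1 i 0 - u k i 0| <= (r * h k.+1)%:C).
  elim: k => [|k [IHc IHd]].
    split=> i; first by rewrite subrr normr0 expr0 mulr1 subrr.
    by rewrite expr1; apply: T_center.
  have hk j : near_center (u j) -> near_center (u j) by [].
  have hS : r * h k.+1 = r * h k / 2 by rewrite exprS; field.
  have hr j : 0 <= r * h j by rewrite mulr_ge0 // half_ge0.
  have c1 i : `|u k.+1 i 0 - x0 i 0| <= (r - r * h k.+1)%:C.
    rewrite [_ - _](_ : _ = (u k.+1 i 0 - u k i 0) + (u k i 0 - x0 i 0)); last by ring.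
    apply: le_trans (ler_normD _ _) _; apply: le_trans (lerD (IHd i) (IHc i)) _.
    by rewrite -rmorphD lecR hS; lra.
  split=> // i.
  rewrite [r * h k.+2](_ : _ = r * h k.+1 / 2); last by rewrite [h k.+2]exprS; field.
  apply: T_contracts => // j.
  - by apply: le_trans (c1 j) _; rewrite lecR; have := hr k.+1; lra.
  - by apply: le_trans (IHc j) _; rewrite lecR; have := hr k; lra.
have lim i : exists l, forall k, `|u k i 0 - l| <= (r * h k *+ 2)%:C.
  by apply: geometric_cauchy => k; have [_ ->] := uP k.
have [l lP] := fin_all_exists lim.
pose x : 'cV[C]_n := \col_i l i.
have xl i k : `|u k i 0 - x i 0| <= (r * h k *+ 2)%:C by rewrite mxE.
have ubox k : near_center (u k).
  move=> i; have [/(_ i) ui _] := uP k; apply: le_trans ui _.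
  by rewrite lecR lerBlDr lerDl mulr_ge0 // half_ge0.
have xbox : near_center x.
  move=> i; apply: norm_le_geometric (r * 4) _ => k.
  rewrite [_ - _](_ : _ = (u k i 0 - x0 i 0) - (u k i 0 - x i 0)); last by ring.
  apply: le_trans (ler_normB _ _) _; apply: le_trans (lerD (ubox k i) (xl i k)) _.
  have hk : 0 <= r * h k by rewrite mulr_ge0 // half_ge0.
  by rewrite -rmorphD lecR; lra.
(* Both x and T x are at distance O(2^-k) from the iterate of index k + 1. *)
exists x => //; apply/colP => i; apply/eqP; rewrite -subr_eq0 -normr_le0.
have -> : 0 = (0 : R)%:C by [].
apply: norm_le_geometric (r * 4) _ => k.
rewrite [_ - _](_ : _ = (u k.+1 i 0 - x i 0) - (u k.+1 i 0 - T x i 0)); last by ring.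
apply: le_trans (ler_normB _ _) _.
have Tu : `|u k.+1 i 0 - T x i 0| <= (r * h k *+ 2 / 2)%:C.
  by apply: T_contracts => // j.
apply: le_trans (lerD (xl i k.+1) Tu) _.
have hk : 0 <= r * h k by rewrite mulr_ge0 // half_ge0.
by rewrite -rmorphD lecR exprS; lra.
Qed.

End FixedPoint.
(* M approximates the inverse of the divided difference S of F, and G is a     *)
(* small perturbation.                                                        *)
Lemma newton_perturbed n (x0 : 'cV[C]_n) (r : R) (M : 'M[C]_n)
    (F G : 'cV[C]_n -> 'cV[C]_n) : 0 <= r ->
  (forall x y, near_center x0 r x -> near_center x0 r y ->
     exists2 S : 'M[C]_n, F x - F y = S *m (x - y) &
       forall i, \sum_j `|(1%:M - M *m S) i j| <= (3 / 8)%:C) ->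
  (forall x y d, near_center x0 r x -> near_center x0 r y ->
     (forall i, `|x i 0 - y i 0| <= d%:C) ->
     forall i, `|(M *m (G x - G y)) i 0| <= (d / 8)%:C) ->
  (forall i, `|(M *m (F x0 + G x0)) i 0| <= (r / 2)%:C) ->
  exists2 x, near_center x0 r x & F x + G x = 0.
Proof.
move=> r0 FS GM FG0; pose T x := x - M *m (F x + G x).
have x0box : near_center x0 r x0 by move=> i; rewrite subrr normr0 lecR.
have [|i|x xbox Tx] := @contraction_fixpoint n x0 r T _ _ r0.
- move=> x y d xb yb xyd i.
  have d0 : 0 <= d by rewrite -ler0c; apply: le_trans (xyd i).
  have [S FE SM] := FS x y xb yb.
  have -> : T x i 0 - T y i 0 =
      ((1%:M - M *m S) *m (x - y)) i 0 - (M *m (G x - G y)) i 0.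
    transitivity ((T x - T y) i 0); first by rewrite !mxE.
    transitivity (((1%:M - M *m S) *m (x - y) - M *m (G x - G y)) i 0).
      congr ((_ : 'cV__) i 0); rewrite /T mulmxBl mul1mx -mulmxA -FE.
      rewrite !mulmxBr !mulmxDr.
      move: (M *m F x) (M *m G x) (M *m F y) (M *m G y) => a b c e.
      by apply/colP => k; rewrite !mxE; ring.
    by rewrite [LHS]mxE [X in _ + X]mxE.
  apply: le_trans (ler_normB _ _) _.
  have xyd' j : `|(x - y) j 0| <= d%:C by rewrite !mxE.
  (* 3/8 from F and 1/8 from G add up to the contraction factor 1/2. *)
  apply: le_trans (lerD (mulmx_row_bound SM xyd' d0 i) (GM x y d xb yb xyd i)) _.
  by rewrite -rmorphD lecR; lra.
- by rewrite /T !mxE addrAC subrr add0r normrN; have := FG0 i; rewrite !mxE.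
exists x => //.
(* The bound at x = y makes M S invertible, hence M too, so that M (F x + G x) = 0 gives a genuine
   zero. *)
have [S _ SM] := FS x x xbox xbox.
have MS : M *m S \in unitmx.
  apply: near_id_unitmx => i; apply: le_trans (SM i) _.
  by rewrite lecR; lra.
have Mu : M \in unitmx by move: MS; rewrite unitmx_mul => /andP[].
have : M *m (F x + G x) = 0 by apply: (subrI x); rewrite subr0.
by move/(congr1 (mulmx (invmx M))); rewrite mulKmx // mulmx0.
Qed.

End Newton.

(** * Certified computation *)

Section BallArithmetic.

Local Open Scope Z_scope.

(* At precision P, the triple (a, b, r) stands for the disc of the complex z   *)
(* such that |2^P z - (a + b i)| <= r.                                        *)
Definition ball : Type := Z * Z * Z.

Definition bzero : ball := (0, 0, 0).
Definition badd (A B : ball) : ball :=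
  let: (a, b, r) := A in let: (c, d, s) := B in (a + c, b + d, r + s).
Definition bsub (A B : ball) : ball :=
  let: (a, b, r) := A in let: (c, d, s) := B in (a - c, b - d, r + s).
Definition norm1 (a b : Z) := Z.abs a + Z.abs b.
Definition bnorm (A : ball) : Z := let: (a, b, r) := A in norm1 a b + r.
(* Flooring both coordinates moves the center by less than 2. *)
Definition bround (P : Z) (A : ball) : ball :=
  let: (a, b, r) := A in
  (Z.shiftr a P, Z.shiftr b P, Z.shiftr r P + 3).
Definition bmul (P : Z) (A B : ball) : ball :=
  let: (a, b, r) := A in let: (c, d, s) := B in
  bround P (a * c - b * d, a * d + b * c,
            norm1 a b * s + norm1 c d * r + r * s).
Definition bnonzero (A : ball) : bool :=
  let: (a, b, r) := A in (r <? Z.abs a) || (r <? Z.abs b).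

Definition bquad (A : ball) := let B := badd A A in badd B B.
(** Encloses x^3 + x^2 y + x y^2 + y^3 for all x, y in [A]: four different numbers in one ball,
    whence the sum of four copies. *)
Definition bcube4 P (A : ball) := bquad (bmul P A (bmul P A A)).
Definition bpow4 P (A : ball) := let B := bmul P A A in bmul P B B.

(** The entries of M are exact Gaussian integers over 2^[mprec], so this product is not rounded and
    its result has precision [prec] + [mprec]. *)
Definition gscale (m : Z * Z) (A : ball) : ball :=
  let: (x, y) := m in let: (a, b, r) := A in
  (x * a - y * b, x * b + y * a, norm1 x y * r).

Definition bsum (n : nat) (f : nat -> ball) : ball :=
  foldr (fun k A => badd (f k) A) bzero (iota 0 n).

Definition bdot (m : seq (Z * Z)) (s : seq ball) : ball :=
  bsum 14 (fun k => gscale (nth (0, 0) m k) (nth bzero s k)).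

(** In units of 2^-30 one unit 2^-20 of the data is 1024, so the radius of the boxes is nearly ten
    units of the data. *)
Definition prec := 30.
Definition mprec := 16.
Definition radius := 10000.

(* The 14 pairs of non adjacent lines of a heptagon. *)
Definition chords : seq (nat * nat) :=
  [:: (0,2); (0,3); (0,4); (0,5); (1,3); (1,4); (1,5); (1,6);
      (2,4); (2,5); (2,6); (3,5); (3,6); (4,6)]%nat.

(* The list rep holds the x_0, y_0, ..., x_6, y_6 in units of 2 ^ -20, where   *)
(* line i of the heptagon has coordinates (x_i : y_i : 1).                    *)
Definition center (rep : seq (Z * Z)) (rho : Z) (n : nat) : ball :=
  let: (a, b) := nth (0, 0) rep n in (Z.shiftl a 10, Z.shiftl b 10, rho).

(** The cross product of (x_i, y_i, 1) and (x_j, y_j, 1). *)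
Definition chord_point rep rho (ij : nat * nat) : ball * ball * ball :=
  let: (i, j) := ij in
  let c := center rep rho in
  (bsub (c i.*2.+1) (c j.*2.+1), bsub (c j.*2) (c i.*2),
   bsub (bmul prec (c i.*2) (c j.*2.+1)) (bmul prec (c i.*2.+1) (c j.*2))).

Definition chord_value rep (ij : nat * nat) : ball :=
  let: (X, Y, Z) := chord_point rep 0 ij in
  badd (badd (bpow4 prec X) (bpow4 prec Y)) (bpow4 prec Z).

(* Divided differences of X^4 + Y^4 + Z^4 in x_i, y_i, x_j and y_j, where      *)
(* (X : Y : Z) is the intersection of lines i and j.                          *)
Definition chord_slopes rep rho (ij : nat * nat) : ball * ball * ball * ball :=
  let: (X, Y, Z) := chord_point rep rho ij in
  let: (i, j) := ij in
  let c := center rep rho in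
  let x := bcube4 prec X in let y := bcube4 prec Y in let z := bcube4 prec Z in
  (bsub (bmul prec z (c j.*2.+1)) y, bsub x (bmul prec z (c j.*2)),
   bsub y (bmul prec z (c i.*2.+1)), bsub (bmul prec z (c i.*2)) x).

Definition slope_entry (n : nat) (ij : nat * nat)
    (s : ball * ball * ball * ball) : ball :=
  let: (i, j) := ij in let: (a, b, c, d) := s in
  if n == i.*2 then a else if n == i.*2.+1 then b else
  if n == j.*2 then c else if n == j.*2.+1 then d else bzero.

Definition slope_columns rep rho : seq (seq ball) :=
  let rows := [seq (ij, chord_slopes rep rho ij) | ij <- chords] in
  [seq [seq slope_entry n row.1 row.2 | row <- rows] | n <- iota 0 14].

Definition scaled_one := Z.shiftl 1 (prec + mprec).

(** Both bounds are 3/8 instead of the 1/2 of the contraction argument; the remaining 1/8 is left to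
    the perturbation of the quartic. *)
Definition check_row cols vals (i : nat) (m : seq (Z * Z)) : bool :=
  (8 * foldr (fun j b => bnorm (bsub (if i == j then (scaled_one, 0, 0) else bzero)
                                     (bdot m (nth [::] cols j))) + b) 0 (iota 0 14)
     <=? 3 * scaled_one)
  && (8 * bnorm (bdot m vals) <=? 3 * Z.shiftl radius mprec).

Definition check_newton rep (M : seq (seq (Z * Z))) : bool :=
  let cols := slope_columns rep radius in
  let vals := [seq chord_value rep ij | ij <- chords] in
  all (fun i => check_row cols vals i (nth [::] M i)) (iota 0 14).

(* Gauss-Jordan elimination in rounded arithmetic: nothing is proved about it, *)
(* since check_newton validates its output.                                   *)
Definition gmul (x y : Z * Z) : Z * Z :=
  (Z.shiftr (x.1 * y.1 - x.2 * y.2) prec, Z.shiftr (x.1 * y.2 + x.2 * y.1) prec).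
Definition ginv (x : Z * Z) : Z * Z :=
  let n := x.1 * x.1 + x.2 * x.2 in
  (Z.shiftl x.1 (2 * prec) / n, - Z.shiftl x.2 (2 * prec) / n).
Definition gnorm (x : seq (Z * Z)) := norm1 (head (0,0) x).1 (head (0,0) x).2.

Fixpoint pivot (best : seq (Z * Z)) (acc rows : seq (seq (Z * Z))) :=
  match rows with
  | [::] => (best, acc)
  | r :: rows => if gnorm best <? gnorm r then pivot r (best :: acc) rows
                 else pivot best (r :: acc) rows
  end.
Fixpoint gauss_jordan (n : nat) (done todo : seq (seq (Z * Z))) :=
  match n, todo with
  | n.+1, r :: rows =>
      let: (p, rows) := pivot r [::] rows in
      let p := [seq gmul (ginv (head (0,0) p)) x | x <- behead p] in
      let elim row := [seq (x.1.1 - (gmul (head (0,0) row) x.2).1,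
                            x.1.2 - (gmul (head (0,0) row) x.2).2)
                        | x <- zip (behead row) p] in
      gauss_jordan n (rcons (map elim done) p) (map elim rows)
  | _, _ => done
  end.
Definition approx_inverse rep : seq (seq (Z * Z)) :=
  let cols := slope_columns rep 0 in
  let rows := [seq [seq (let: (a, b, _) := nth bzero (nth [::] cols j) i in (a, b))
                     | j <- iota 0 14] ++
                   [seq (if j == i then (Z.shiftl 1 prec, 0) else (0, 0)) | j <- iota 0 14]
               | i <- iota 0 14] in
  [seq [seq (Z.shiftr x.1 (prec - mprec), Z.shiftr x.2 (prec - mprec)) | x <- row]
    | row <- gauss_jordan 14 [::] rows].

Definition det3 rep (i j k : nat) : ball :=
  let: (X, Y, Z) := chord_point rep radius (i, j) in
  let c := center rep radius in
  badd (badd (bmul prec X (c k.*2)) (bmul prec Y (c k.*2.+1))) Z.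

Definition check_generic rep : bool :=
  all (fun i => all (fun j => all (fun k => bnonzero (det3 rep i j k))
    (iota j.+1 (6 - j))) (iota i.+1 (6 - i))) (iota 0 7).

(* Obtained by numerical continuation from random heptagons. *)
Definition reps : seq (seq (Z * Z)) := [::
  [:: (-2926422,1722610); (242267,-3319206); (745902,-630668);
    (-1213027,-446233); (-9251,1483916); (-1264590,383563); (-4619,740924);
    (276596,-891869); (859573,-726777); (-685094,1206560); (-279034,164251);
    (-584395,-845317); (885867,561027); (-29227,-8476)] ;
  [:: (-529746,6888); (-929819,-1022161); (-417305,-108778);
    (-927358,875425); (-2467153,-643107); (2628515,-1645033); (-2075195,26981);
    (-2046843,-1813866); (1298222,-79979); (-362324,70388); (-711023,770686);
    (48619,19002); (843734,-51979); (-38677,295032)] ;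
  [:: (994797,-34081); (-857206,420040); (571713,1333565); (463766,-254233);
    (-713183,70216); (271063,-862434); (847765,2780828); (87887,168127);
    (263884,912990); (656827,97199); (55031,-301529); (-780454,-859261);
    (-43886,1106835); (578165,451827)] ;
  [:: (994797,34081); (-857206,-420040); (571713,-1333565); (463766,254233);
    (-713183,-70216); (271063,862434); (847765,-2780828); (87887,-168127);
    (263884,-912990); (656827,-97199); (55031,301529); (-780454,859261);
    (-43886,-1106835); (578165,-451827)] ;
  [:: (-170057,-16029); (657411,737020); (686461,83064); (436268,-685998);
    (932661,61780); (86238,1610631); (1789039,-66001); (1789039,66001);
    (86238,-1610631); (932661,-61780); (436268,685998); (686461,-83064);
    (657411,-737020); (-170057,16029)] ;
  [:: (-931888,580952); (382554,-66398); (1293452,727069);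
    (1426507,-918479); (-600809,2085491); (-1587498,-1562705); (458436,1028782);
    (-277309,1193226); (202325,94547); (832821,-767309); (-456438,105408);
    (-271383,-106274); (992730,-1082425); (-439811,-926)] ;
  [:: (-931888,-580952); (382554,66398); (1293452,-727069);
    (1426507,918479); (-600809,-2085491); (-1587498,1562705); (458436,-1028782);
    (-277309,-1193226); (202325,-94547); (832821,767309); (-456438,-105408);
    (-271383,106274); (992730,1082425); (-439811,926)] ;
  [:: (-393852,224949); (-514871,-315926); (676815,-656378);
    (-260575,-461966); (-1802972,-472876); (-1018461,-1805600);
    (690372,-378496); (-1551395,-951939); (-471883,-899232); (372980,420228);
    (-77703,-218374); (-662357,-812893); (455350,1839658); (1298981,1463532)] ;
  [:: (1038290,14); (-630791,837435); (496362,-1796661); (504029,-628047);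
    (-496362,-1796661); (-628047,504029); (-1038290,14); (837435,-630791);
    (290329,-768740); (-232854,-643399); (0,316835); (882859,882859);
    (-290329,-768740); (-643399,-232854)]].

Definition inverses := Eval vm_compute in map approx_inverse reps.

(** Six bits are enough to tell the lines apart: 24 of the 30 bits are dropped, and 64 is the third
    coordinate 1 at this precision. *)
Definition sprec := 6.
Definition coarse rep (i : nat) : seq ball :=
  [:: bround 24 (center rep radius i.*2); bround 24 (center rep radius i.*2.+1); (64, 0, 0)].
Definition brot (A : ball) : ball := let: (a, b, r) := A in (- b, a, r).
(** The ball version of [gact] with last exponent 0; 3 - k stands for -k modulo 3. *)
Definition bact (e0 e1 t : nat) (s : bool) (v : seq ball) : seq ball :=
  let w k := nth bzero v ((if s then t + (3 - k) else t + k)%nat %% 3) in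
  [:: iter e0 brot (w 0%N); iter e1 brot (w 1%N); w 2%N].
Definition lines_differ (v w : seq ball) : bool :=
  has (fun ij => bnonzero (bsub (bmul sprec (nth bzero v ij.1) (nth bzero w ij.2))
     (bmul sprec (nth bzero v ij.2) (nth bzero w ij.1))))
   [:: (1,2); (2,0); (0,1)]%nat.
Definition separatedb (H H' : seq (seq ball)) :=
  has (fun v => all (lines_differ v) H') H.
(* If two of the 864 heptagons g H_n and g' H_m coincide, so do H_n and        *)
(* g^-1 g' H_m; the exponent of i on the last coordinate can be normalised.    *)
Definition check_sep : bool :=
  let cs := [seq [seq coarse rep i | i <- iota 0 7] | rep <- reps] in
  all (fun n => all (fun m => all (fun e0 => all (fun e1 => all (fun t => all (fun s =>
   [&& n == m, e0 == 0, e1 == 0, t == 0 & ~~ s]%nat ||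
   separatedb (nth [::] cs n) (map (bact e0 e1 t s) (nth [::] cs m)))
   [:: false; true]) (iota 0 3)) (iota 0 4)) (iota 0 4)) (iota n (9 - n))) (iota 0 9).

End BallArithmetic.

(** * Soundness of the ball arithmetic *)

(* Locked because unfolding turns large integers into unary ones. *)
HB.lock Definition zr (R : realType) (a : Z) : R := (int_of_Z a)%:~R.

Section BallSoundness.

Variable R : realType.
Notation C := R[i].

Local Notation zr := (zr R).
Definition zc (a b : Z) : C := Complex (zr a) (zr b).

Lemma zrD a b : zr (Z.add a b) = zr a + zr b.
Proof. by rewrite !zr.unlock -intrD; congr (_%:~R); lia. Qed.

Lemma zrB a b : zr (Z.sub a b) = zr a - zr b.
Proof. by rewrite !zr.unlock -intrB; congr (_%:~R); lia. Qed.

Lemma zrM a b : zr (Z.mul a b) = zr a * zr b.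
Proof. by rewrite !zr.unlock -intrM; congr (_%:~R); lia. Qed.

Lemma zr_le a b : (zr a <= zr b) = (Z.leb a b).
Proof. by rewrite !zr.unlock ler_int; lia. Qed.

Lemma zr_lt a b : (zr a < zr b) = (Z.ltb a b).
Proof. by rewrite !zr.unlock ltr_int; lia. Qed.

Lemma zr_abs a : zr (Z.abs a) = `|zr a|.
Proof. by rewrite !zr.unlock -intr_norm; congr (_%:~R); lia. Qed.

Lemma zr_nat n : zr (Z.of_nat n) = n%:R.
Proof. by rewrite zr.unlock [RHS]pmulrn; congr (_%:~R); lia. Qed.

Lemma zr0 : zr Z0 = 0. Proof. exact: zr_nat 0%N. Qed.
Lemma zr1 : zr (Zpos xH) = 1. Proof. exact: zr_nat 1%N. Qed.
Lemma zr3 : zr (Zpos (xI xH)) = 3. Proof. exact: zr_nat 3%N. Qed.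
Lemma zr8 : zr (Zpos (xO (xO (xO xH)))) = 8. Proof. exact: zr_nat 8%N. Qed.

Lemma zrX k : Z.le 0 k -> zr (Z.pow 2 k) = 2 ^+ Z.to_nat k.
Proof.
move=> k0; rewrite -[in LHS](Z2Nat.id k) //.
elim: (Z.to_nat k) => [|n IH]; first exact: zr1.
rewrite Nat2Z.inj_succ Z.pow_succ_r; last by lia.
by rewrite zrM IH exprS -(zr_nat 2).
Qed.

Lemma zr2k_gt0 k : Z.le 0 k -> 0 < zr (Z.pow 2 k).
Proof. by move=> /zrX->; rewrite exprn_gt0. Qed.

Lemma zr_shiftr a k : Z.le 0 k ->
  0 <= zr a / zr (Z.pow 2 k) - zr (Z.shiftr a k) <= 1.
Proof.
move=> k0; have p0 := zr2k_gt0 k0.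
have -> : zr a / zr (Z.pow 2 k) - zr (Z.shiftr a k) =
    (zr a - zr (Z.mul (Z.pow 2 k) (Z.shiftr a k))) / zr (Z.pow 2 k).
  by rewrite zrM; field; rewrite gt_eqF.
rewrite divr_ge0 ?(ltW p0) //= ?ler_pdivrMr // ?mul1r -?zrB -?zr0 ?zr_le.
  rewrite Z.shiftr_div_pow2 //.
  have := Z.mod_pos_bound a (Z.pow 2 k); have := Z.div_mod a (Z.pow 2 k); lia.
rewrite Z.shiftr_div_pow2 //.
have := Z.mod_pos_bound a (Z.pow 2 k); have := Z.div_mod a (Z.pow 2 k); lia.
Qed.

Definition in_ball (P : Z) (z : C) (A : ball) : Prop :=
  `|(zr (Z.pow 2 P))%:C * z - zc A.1.1 A.1.2| <= (zr A.2)%:C.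

Lemma zc_norm1 a b : `|zc a b| <= (zr (norm1 a b))%:C.
Proof.
by apply: le_trans (norm_le_ReIm _) _; rewrite lecR /norm1 zrD !zr_abs.
Qed.

Lemma zcD a b c d : zc (Z.add a c) (Z.add b d) = zc a b + zc c d.
Proof. by rewrite /zc !zrD. Qed.

Lemma zcB a b c d : zc (Z.sub a c) (Z.sub b d) = zc a b - zc c d.
Proof. by rewrite /zc !zrB. Qed.

Lemma zcM a b c d :
  zc (Z.sub (Z.mul a c) (Z.mul b d)) (Z.add (Z.mul a d) (Z.mul b c)) =
  zc a b * zc c d.
Proof. by rewrite /zc !(zrB, zrD, zrM); apply/eqP; rewrite eq_complex /= !eqxx. Qed.

Lemma in_bzero P : in_ball P 0 bzero.
Proof. by rewrite /in_ball mulr0 sub0r normrN /zc zr0 normr0. Qed.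

Lemma in_badd P x y A B :
  in_ball P x A -> in_ball P y B -> in_ball P (x + y) (badd A B).
Proof.
case: A B => [[a b] r] [[c d] s]; rewrite /in_ball /= => xA yB.
rewrite zcD zrD rmorphD /=; apply: le_trans (lerD xA yB).
by apply: le_trans (ler_normD _ _); rewrite mulrDr addrACA opprD.
Qed.

Lemma in_bsub P x y A B :
  in_ball P x A -> in_ball P y B -> in_ball P (x - y) (bsub A B).
Proof.
case: A B => [[a b] r] [[c d] s]; rewrite /in_ball /= => xA yB.
rewrite zcB zrD rmorphD /=; apply: le_trans (lerD xA yB).
apply: le_trans (ler_normB _ _); set p := _%:C.
by rewrite [X in _ <= `|X|](_ : _ = p * (x - y) - (zc a b - zc c d)) //; ring.
Qed.

Lemma in_bnorm P z A : in_ball P z A -> `|(zr (Z.pow 2 P))%:C * z| <= (zr (bnorm A))%:C.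
Proof.
case: A => [[a b] r]; rewrite /in_ball /bnorm zrD rmorphD /= => zA.
rewrite -[_ * z](subrK (zc a b)) addrC; apply: le_trans (ler_normD _ _) _.
by rewrite lerD // zc_norm1.
Qed.

Lemma in_bnonzero P z A : in_ball P z A -> bnonzero A -> z != 0.
Proof.
case: A => [[a b] r]; rewrite /in_ball /= => zA; apply: contraTneq => z0.
move: zA; rewrite z0 mulr0 sub0r normrN => zA.
have := Re_norm_le zA; have := Im_norm_le zA; rewrite /= -!zr_abs !zr_le.
by rewrite negb_or; lia.
Qed.

(** The 3 pays for three floors: one unit for each coordinate of the center and one for the
    radius. *)
Lemma in_bround (k : Z) (w : C) a b r : Z.le 0 k ->
  `|w - zc a b| <= (zr r)%:C ->
  `|w / (zr (Z.pow 2 k))%:C - zc (Z.shiftr a k) (Z.shiftr b k)|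
     <= (zr (Z.add (Z.shiftr r k) 3))%:C.
Proof.
move=> k0 wr; have p0 := zr2k_gt0 k0; set p := zr _ in p0 *.
have pC : p%:C != 0 :> C by rewrite gt_eqF // ltcR.
have -> : w / p%:C - zc (Z.shiftr a k) (Z.shiftr b k) = (w - zc a b) / p%:C +
    Complex (zr a / p - zr (Z.shiftr a k)) (zr b / p - zr (Z.shiftr b k)).
  have -> : Complex (zr a / p - zr (Z.shiftr a k)) (zr b / p - zr (Z.shiftr b k))
     = zc a b / p%:C - zc (Z.shiftr a k) (Z.shiftr b k).
    apply: (mulIf pC); rewrite mulrBl divfK //.
    apply/eqP; rewrite eq_complex /= !(mulr0, subr0, addr0, add0r).
    by apply/andP; split; apply/eqP; field; rewrite gt_eqF.
  by rewrite mulrBl addrA subrK.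
apply: le_trans (ler_normD _ _) _.
rewrite normrM normfV [`|p%:C|]ger0_norm ?ler0c ?(ltW p0) //.
have le1 : `|w - zc a b| / p%:C <= (zr r / p)%:C.
  by rewrite fmorph_div /= ler_wpM2r // invr_ge0 ler0c ltW.
apply: le_trans (lerD le1 (norm_le_ReIm _)) _ => /=.
have /andP[ra rb] := zr_shiftr r k0; have /andP[aa ab] := zr_shiftr a k0.
have /andP[ba bb] := zr_shiftr b k0; rewrite -/p in ra rb aa ab ba bb.
rewrite -rmorphD lecR !ger0_norm // zrD zr3; lra.
Qed.

Lemma in_bmul P x y A B : Z.le 0 P ->
  in_ball P x A -> in_ball P y B -> in_ball P (x * y) (bmul P A B).
Proof.
case: A B => [[a b] r] [[c d] s] P0; rewrite /in_ball /= => xA yB.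
set p := (zr (Z.pow 2 P))%:C in xA yB *.
have pC : p != 0 by rewrite gt_eqF // ltcR zr2k_gt0.
rewrite (_ : p * (x * y) = (p * x) * (p * y) / p); last by rewrite [p * y]mulrC !mulrA mulfK.
apply: in_bround => //; rewrite zcM.
set u := p * x in xA *; set v := p * y in yB *.
set m := zc a b in xA *; set n := zc c d in yB *.
have -> : u * v - m * n = m * (v - n) + n * (u - m) + (u - m) * (v - n) by ring.
rewrite !zrD !zrM !rmorphD /= !rmorphM /=.
apply: le_trans (ler_normD _ _) _; apply: lerD.
  apply: le_trans (ler_normD _ _) _.
  by rewrite !normrM; apply: lerD; apply: ler_pM => //; apply: zc_norm1.
by rewrite normrM; apply: ler_pM.
Qed.

Lemma in_gscale P m z A :
  in_ball P z A -> in_ball P (zc m.1 m.2 * z) (gscale m A).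
Proof.
case: m A => [x y] [[a b] r]; rewrite /in_ball /= => zA.
rewrite zcM mulrCA -mulrBr normrM zrM rmorphM /=.
by apply: ler_pM => //; apply: zc_norm1.
Qed.

Lemma in_bsum P n (f : nat -> C) (g : nat -> ball) :
  (forall k, (k < n)%N -> in_ball P (f k) (g k)) ->
  in_ball P (\sum_(k < n) f k) (bsum n g).
Proof.
rewrite /bsum -(big_mkord xpredT) /index_iota subn0 => fg.
have {}fg : {in iota 0 n, forall k, in_ball P (f k) (g k)}.
  by move=> k; rewrite mem_iota => /fg.
elim: (iota 0 n) fg => [|k s IH] fg; first by rewrite big_nil; apply: in_bzero.
rewrite big_cons; apply: in_badd; first by apply: fg; rewrite inE eqxx.
by apply: IH => i si; apply: fg; rewrite inE si orbT.
Qed.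

Lemma in_bquad P x1 x2 x3 x4 A :
  in_ball P x1 A -> in_ball P x2 A -> in_ball P x3 A -> in_ball P x4 A ->
  in_ball P ((x1 + x2) + (x3 + x4)) (bquad A).
Proof. by move=> *; do ![apply: in_badd]. Qed.

(** The grouping follows the operations of [bcube4]. *)
Definition slope4 (x y : C) := (x * (x * x) + x * (x * y)) + (x * (y * y) + y * (y * y)).

Lemma slope4E x y : x ^+ 4 - y ^+ 4 = slope4 x y * (x - y).
Proof. by rewrite /slope4; ring. Qed.

Lemma in_bcube4 P x y A : Z.le 0 P ->
  in_ball P x A -> in_ball P y A -> in_ball P (slope4 x y) (bcube4 P A).
Proof. by move=> P0 xA yA; apply: in_bquad; do ![apply: in_bmul]. Qed.

Lemma in_bpow4 P x A : Z.le 0 P ->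
  in_ball P x A -> in_ball P (x ^+ 4) (bpow4 P A).
Proof.
move=> P0 xA; rewrite (_ : x ^+ 4 = (x * x) * (x * x)); last by ring.
by do ![apply: in_bmul].
Qed.

End BallSoundness.

(** * Quartics near the Fermat quartic *)

Section QuarticEvaluation.

Variable K : comNzRingType.
Implicit Types (c : 'X_{1..3} -> K) (v : 'I_3 -> K).

(** Coefficients are any function of the monomial, so that perturbations, twists and environments of
    formulas can be plugged in directly. *)
Definition qeval c v : K :=
  \sum_(m <- (quartic_monomials : seq _)) c m * \prod_k v k ^+ m k.

Lemma meval_quartic (q : {mpoly K[3]}) v :
  q \is 4.-homog -> q.@[v] = qeval (fun m => q@_m) v.
Proof.
move=> /dhomogP hq; rewrite mevalE /qeval.
have sub : {subset msupp q <= (quartic_monomials : seq _)}.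
  by move=> m /hq m4; rewrite mem_quartic_monomials; apply/eqP.
rewrite [RHS](bigID (mem (msupp q))) /= [X in _ + X]big1 ?addr0; last first.
  by move=> m /memN_msupp_eq0->; rewrite mul0r.
rewrite -[RHS]big_filter; apply: perm_big; apply: uniq_perm.
- exact: msupp_uniq.
- by rewrite filter_uniq // quartic_monomials_uniq.
by move=> m; rewrite mem_filter /=; have [/sub->|] := boolP (m \in msupp q).
Qed.

(** Among monomials of degree 4, those with an exponent 4 are exactly the pure powers. *)
Definition fermat (m : 'X_{1..3}) : K := [exists k, m k == 4%N]%:R.

Lemma monom3_nth a b d :
  [/\ monom3 a b d 0 = a, monom3 a b d 1 = b & monom3 a b d (-1) = d].
Proof. by rewrite !multinomE !(tnth_nth 0%N). Qed.

Lemma exists3E (P : pred 'I_3) : [exists k, P k] = [|| P 0, P 1 | P (-1)].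
Proof.
apply/existsP/idP => [[k]|]; last by case/or3P=> Pk; eexists; apply: Pk.
by move: k; apply: ord3E => ->; rewrite ?orbT.
Qed.

Lemma prod3E (F : 'I_3 -> K) : \prod_i F i = F 0 * F 1 * F (-1).
Proof.
rewrite !big_ord_recr big_ord0 /= mul1r.
by congr (F _ * F _ * F _); apply: val_inj.
Qed.

Lemma qeval_fermat v : qeval fermat v = v 0 ^+ 4 + v 1 ^+ 4 + v (-1) ^+ 4.
Proof.
rewrite /qeval /= !big_cons big_nil /fermat !exists3E !prod3E.
do 15!(match goal with |- context [monom3 ?a ?b ?d] =>
  have [-> -> ->] := monom3_nth a b d end).
rewrite /=; ring.
Qed.

Lemma qevalD c d v : qeval (fun m => c m + d m) v = qeval c v + qeval d v.
Proof. by rewrite /qeval -big_split /=; apply: eq_bigr => m _; rewrite mulrDl. Qed.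

End QuarticEvaluation.

(** * Bounds for small perturbations of the system *)

Section Representatives.

Variable R : realType.
Notation C := R[i].
Notation point := 'cV[C]_14.
Implicit Types (x y : point).

Definition pcoord x (n : nat) : C := x (inord n) 0.

Definition chart_line x (i : nat) : 'I_3 -> C :=
  fun k => if k == 0 then pcoord x i.*2 else
           if k == 1 then pcoord x i.*2.+1 else 1.

Definition chord (k : nat) := nth (0%N, 0%N) chords k.

Definition chord_cross x (ij : nat * nat) :=
  cross (chart_line x ij.1) (chart_line x ij.2).

Lemma chord_crossE x ij :
  [/\ chord_cross x ij 0 = pcoord x ij.1.*2.+1 - pcoord x ij.2.*2.+1,
      chord_cross x ij 1 = pcoord x ij.2.*2 - pcoord x ij.1.*2
    & chord_cross x ij (-1) = pcoord x ij.1.*2 * pcoord x ij.2.*2.+1 -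
        pcoord x ij.1.*2.+1 * pcoord x ij.2.*2].
Proof. by rewrite /chord_cross cross0 cross1 cross2 /chart_line /= !mulr1 !mul1r. Qed.

Definition chord_map (c : 'X_{1..3} -> C) x : point :=
  \col_k qeval c (chord_cross x (chord k)).

Section BoundedLipschitz.

Variables (x0 : point) (r : R).

(** The bound and the Lipschitz constant are kept together because the Lipschitz estimate of a
    product needs both. *)
Definition bounded_lipschitz (f : point -> C) := exists2 B : R, 0 <= B &
  forall x y d, near_center x0 r x -> near_center x0 r y ->
    (forall i, `|x i 0 - y i 0| <= d%:C) ->
    `|f x| <= B%:C /\ `|f x - f y| <= (B * d)%:C.

Lemma near_dist_ge0 (x y : point) (d : R) :
  (forall i, `|x i 0 - y i 0| <= d%:C) -> 0 <= d.
Proof. by move=> /(_ 0); rewrite -ler0c; apply: le_trans. Qed.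

Lemma lipschitz_const c : bounded_lipschitz (fun=> c).
Proof.
have [B B0 cB] := norm_complexE c; exists B => // x y d _ _ /near_dist_ge0 d0.
by rewrite cB subrr normr0 ler0c mulr_ge0.
Qed.

Lemma lipschitz_coord n : bounded_lipschitz (fun x => pcoord x n).
Proof.
have [B B0 xB] := norm_complexE (pcoord x0 n).
have B1 : 0 <= B + `|r| by rewrite addr_ge0.
exists (B + `|r| + 1) => [|x y d xb yb xyd]; first by lra.
have d0 := near_dist_ge0 xyd; split.
  rewrite -[pcoord x n](subrK (pcoord x0 n)) addrC.
  apply: le_trans (ler_normD _ _) _; rewrite xB.
  apply: le_trans (lerD (lexx _) (xb (inord n))) _.
  by rewrite -rmorphD lecR; have := ler_norm r; lra.
by apply: le_trans (xyd (inord n)) _; rewrite lecR ler_peMl //; lra.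
Qed.

Lemma lipschitz_add f g : bounded_lipschitz f -> bounded_lipschitz g ->
  bounded_lipschitz (fun x => f x + g x).
Proof.
move=> [A A0 fA] [B B0 gB]; exists (A + B) => [|x y d xb yb xyd].
  exact: addr_ge0.
have [f1 f2] := fA x y d xb yb xyd; have [g1 g2] := gB x y d xb yb xyd.
rewrite mulrDl !rmorphD /= opprD addrACA.
by split; apply: le_trans (ler_normD _ _) _; apply: lerD.
Qed.

Lemma lipschitz_mul f g : bounded_lipschitz f -> bounded_lipschitz g ->
  bounded_lipschitz (fun x => f x * g x).
Proof.
move=> [A A0 fA] [B B0 gB]; exists (A * B *+ 2) => [|x y d xb yb xyd].
  by rewrite mulrn_wge0 // mulr_ge0.
have [f1 f2] := fA x y d xb yb xyd; have [g1 g2] := gB x y d xb yb xyd.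
have [fy _] : `|f y| <= A%:C /\ `|f y - f x| <= (A * d)%:C.
  by apply: fA => // i; rewrite distrC.
have d0 := near_dist_ge0 xyd.
split.
  rewrite normrM; apply: (@le_trans _ _ (A * B)%:C).
    by rewrite rmorphM; apply: ler_pM.
  by rewrite lecR mulr2n lerDl mulr_ge0.
have -> : f x * g x - f y * g y = (f x - f y) * g x + f y * (g x - g y) by ring.
apply: le_trans (ler_normD _ _) _; rewrite !normrM.
apply: (@le_trans _ _ ((A * d) * B + A * (B * d))%:C).
  by rewrite rmorphD; apply: lerD; rewrite rmorphM; apply: ler_pM.
by rewrite lecR; lra.
Qed.

Lemma lipschitz_ext f g : f =1 g -> bounded_lipschitz f -> bounded_lipschitz g.
Proof.
by move=> fg [B B0 fB]; exists B => // x y d; rewrite -!fg; apply: fB.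
Qed.

Lemma lipschitz_exp f n : bounded_lipschitz f -> bounded_lipschitz (fun x => f x ^+ n).
Proof.
move=> fP; elim: n => [|n IH].
  by apply: lipschitz_ext (lipschitz_const 1) => x; rewrite expr0.
by apply: lipschitz_ext (lipschitz_mul fP IH) => x; rewrite exprS.
Qed.

Lemma lipschitz_sum I (s : seq I) (F : I -> point -> C) :
  (forall i, bounded_lipschitz (F i)) -> bounded_lipschitz (fun x => \sum_(i <- s) F i x).
Proof.
move=> FP; elim: s => [|i s IH].
  by apply: (@lipschitz_ext (fun=> 0)) (lipschitz_const 0) => x; rewrite big_nil.
apply: (@lipschitz_ext (fun x => F i x + \sum_(j <- s) F j x)) (lipschitz_add (FP i) IH).
by move=> x; rewrite big_cons.
Qed.

Lemma lipschitz_monomial ij (m : 'X_{1..3}) :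
  bounded_lipschitz (fun x => \prod_k chord_cross x ij k ^+ m k).
Proof.
have lipschitz_line i k : bounded_lipschitz (fun x => chart_line x i k).
  rewrite /chart_line; case: (k == 0); first exact: lipschitz_coord.
  by case: (k == 1); [apply: lipschitz_coord|apply: lipschitz_const].
have lipschitz_cross k : bounded_lipschitz (fun x => chord_cross x ij k).
  rewrite /chord_cross /cross; apply: lipschitz_add; first by apply: lipschitz_mul.
  apply: lipschitz_ext (lipschitz_mul (lipschitz_const (-1))
    (lipschitz_mul (lipschitz_line ij.1 (k - 1)) (lipschitz_line ij.2 (k + 1)))).
  by move=> x; rewrite mulN1r.
apply: (@lipschitz_ext (fun x => chord_cross x ij 0 ^+ m 0 * chord_cross x ij 1 ^+ m 1 *
   chord_cross x ij (-1) ^+ m (-1))).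
  by move=> x; rewrite prod3E.
by apply: lipschitz_mul; [apply: lipschitz_mul|]; apply: lipschitz_exp.
Qed.

(** The system is linear in the 15 coefficients, and each monomial contributes a function that is
    bounded and Lipschitz on the box. *)
Lemma perturbation_small (M : 'M[C]_14) (a : R) : 0 < a ->
  exists2 eps : R, 0 < eps & forall c,
    (forall m, m \in (quartic_monomials : seq _) -> `|c m| <= eps%:C) ->
    forall x y d, near_center x0 r x -> near_center x0 r y ->
      (forall i, `|x i 0 - y i 0| <= d%:C) -> forall i,
      `|(M *m chord_map c x) i 0| <= a%:C /\
      `|(M *m (chord_map c x - chord_map c y)) i 0| <= (a * d)%:C.
Proof.
move=> a0.
pose H i (m : 'X_{1..3}) x := \sum_k M i k * \prod_j chord_cross x (chord k) j ^+ m j.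
have HP i m : bounded_lipschitz (H i m).
  apply: lipschitz_sum => k; apply: lipschitz_mul; first exact: lipschitz_const.
  exact: lipschitz_monomial.
have HE c x i : (M *m chord_map c x) i 0 =
    \sum_(m <- (quartic_monomials : seq _)) c m * H i m x.
  rewrite mxE /H; under [RHS]eq_bigr do rewrite mulr_sumr.
  rewrite exchange_big /=; apply: eq_bigr => k _.
  by rewrite mxE /qeval mulr_sumr; apply: eq_bigr => m _; rewrite mulrCA.
have [B B0 BP] : exists2 B : R, 0 <= B & forall x y d,
    near_center x0 r x -> near_center x0 r y ->
    (forall i, `|x i 0 - y i 0| <= d%:C) -> forall i,
    \sum_(m <- (quartic_monomials : seq _)) `|H i m x| <= B%:C /\
    \sum_(m <- (quartic_monomials : seq _)) `|H i m x - H i m y| <= (B * d)%:C.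
  have Hi i : exists B : R, 0 <= B /\ forall x y d,
    near_center x0 r x -> near_center x0 r y ->
    (forall i, `|x i 0 - y i 0| <= d%:C) ->
    \sum_(m <- (quartic_monomials : seq _)) `|H i m x| <= B%:C /\
    \sum_(m <- (quartic_monomials : seq _)) `|H i m x - H i m y| <= (B * d)%:C.
    elim: (quartic_monomials : seq _) => [|m s [B [B0 BP]]].
      by exists 0; split=> // x y d _ _ _; rewrite !big_nil mul0r.
    have [A A0 AP] := HP i m; exists (A + B); split=> [|x y d xb yb xyd].
      exact: addr_ge0.
    rewrite !big_cons mulrDl !rmorphD.
    have [? ?] := AP x y d xb yb xyd; have [? ?] := BP x y d xb yb xyd.
    by split; apply: lerD.
  have [B BP] := fin_all_exists Hi.
  have B0 i : 0 <= B i by have [] := BP i.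
  exists (\sum_i B i) => [|x y d xb yb xyd i]; first exact: sumr_ge0.
  have [_ /(_ x y d xb yb xyd)[h1 h2]] := BP i.
  have Bi : B i <= \sum_i B i by rewrite (bigD1 i) //= lerDl sumr_ge0.
  split; first by apply: le_trans h1 _; rewrite lecR.
  by apply: le_trans h2 _; rewrite lecR ler_wpM2r // (near_dist_ge0 xyd).
have B1 : 0 < B + 1 by lra.
exists (a / (B + 1)) => [|c cP x y d xb yb xyd i]; first exact: divr_gt0.
have [h1 h2] := BP x y d xb yb xyd i.
have d0 := near_dist_ge0 xyd.
have e0 : 0 <= a / (B + 1) by rewrite divr_ge0 ?ltW.
have eB : a / (B + 1) * B <= a.
  by rewrite mulrAC ler_pdivrMr // ler_wpM2l ?ltW //; lra.
have bound (f : 'X_{1..3} -> C) (b : R) :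
    \sum_(m <- (quartic_monomials : seq _)) `|f m| <= b%:C ->
    `|\sum_(m <- (quartic_monomials : seq _)) c m * f m| <= (a / (B + 1) * b)%:C.
  move=> fb; apply: le_trans (ler_norm_sum _ _ _) _.
  rewrite rmorphM /=; apply: le_trans (ler_wpM2l _ fb); last by rewrite ler0c.
  rewrite mulr_sumr big_seq [leRHS]big_seq; apply: ler_sum => m mq.
  by rewrite normrM ler_wpM2r // cP.
split; first by rewrite HE; apply: le_trans (bound _ _ h1) _; rewrite lecR.
rewrite mulmxBr mxE [X in _ + X]mxE !HE -sumrB.
under eq_bigr do rewrite -mulrBr.
apply: le_trans (bound _ _ h2) _; rewrite lecR mulrA ler_wpM2r //.
Qed.

End BoundedLipschitz.
End Representatives.

(** * Soundness of the certificates *)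

#[local] Arguments Z.shiftl : simpl never.
#[local] Arguments Z.shiftr : simpl never.
#[local] Arguments Z.mul : simpl never.
#[local] Arguments Z.add : simpl never.
#[local] Arguments Z.sub : simpl never.

Section Certificate.

Variable R : realType.
Notation C := R[i].
Notation point := 'cV[C]_14.
Implicit Types (x y : point) (rep : seq (Z * Z)).

Let s : R := zr R (Z.pow 2 prec).

Lemma scale_gt0 : 0 < s. Proof. by apply: zr2k_gt0. Qed.

Lemma scale_ge0 : 0 <= s. Proof. exact/ltW/scale_gt0. Qed.

Lemma scaleC_neq0 : s%:C != 0 :> C.
Proof. by rewrite gt_eqF // ltcR scale_gt0. Qed.

Definition center_point rep : point :=
  \col_n (zc R (center rep 0 n).1.1 (center rep 0 n).1.2 / s%:C).

Definition box_radius : R := zr R radius / s.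

Lemma in_center rep x rho n : (n < 14)%N ->
  (forall i, `|x i 0 - center_point rep i 0| <= (zr R rho / s)%:C) ->
  in_ball prec (pcoord x n) (center rep rho n).
Proof.
move=> n14 /(_ (inord n)); rewrite mxE inordK // /pcoord /center.
case: (nth _ rep n) => a b /= xn.
rewrite /in_ball /= -/s; set z := zc R _ _ in xn *.
rewrite [z](_ : _ = s%:C * (z / s%:C)); last by rewrite mulrC divfK ?scaleC_neq0.
rewrite -mulrBr normrM ger0_norm ?ler0c ?scale_ge0 //.
apply: (@le_trans _ _ (s%:C * (zr R rho / s)%:C)).
  by rewrite ler_wpM2l ?ler0c ?scale_ge0.
by rewrite -rmorphM lecR mulrC divfK // gt_eqF ?scale_gt0.
Qed.

Lemma in_box rep x n : (n < 14)%N -> near_center (center_point rep) box_radius x ->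
  in_ball prec (pcoord x n) (center rep radius n).
Proof. by move=> n14 xb; apply: in_center. Qed.

Lemma in_center0 rep n : (n < 14)%N ->
  in_ball prec (pcoord (center_point rep) n) (center rep 0 n).
Proof.
move=> n14; apply: in_center => // i.
by rewrite subrr normr0 zr0 mul0r.
Qed.

Definition chord_ok (ij : nat * nat) := (ij.1 < ij.2 < 7)%N.

Lemma chord_okP k : (k < 14)%N -> chord_ok (chord k).
Proof. by move: k; do 14![case=> //]. Qed.

Lemma double_bound i j : chord_ok (i, j) ->
  [/\ (i.*2 < 14)%N, (i.*2.+1 < 14)%N, (j.*2 < 14)%N & (j.*2.+1 < 14)%N].
Proof. by rewrite /chord_ok /= => /andP[ij j7]; split; lia. Qed.

Lemma in_chord_point rep rho x ij : chord_ok ij ->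
  (forall n, (n < 14)%N -> in_ball prec (pcoord x n) (center rep rho n)) ->
  [/\ in_ball prec (chord_cross x ij 0) (chord_point rep rho ij).1.1,
      in_ball prec (chord_cross x ij 1) (chord_point rep rho ij).1.2
    & in_ball prec (chord_cross x ij (-1)) (chord_point rep rho ij).2].
Proof.
case: ij => i j /double_bound[i0 i1 j0 j1] xc.
have [-> -> ->] := chord_crossE x (i, j).
split; [apply: in_bsub|apply: in_bsub|apply: in_bsub; apply: in_bmul]; by [|apply: xc].
Qed.

Lemma in_chord_value rep ij : chord_ok ij ->
  in_ball prec (qeval (@fermat _) (chord_cross (center_point rep) ij))
    (chord_value rep ij).
Proof.
move=> ok; have [] := in_chord_point ok (@in_center0 rep).
rewrite qeval_fermat /chord_value.
case: (chord_point rep 0 ij) => [[X Y] Z] /= x1 x2 x3.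
by apply: in_badd; [apply: in_badd|]; apply: in_bpow4.
Qed.

(** The third coordinate of the cross product is bilinear: line i moves first, with line j still at
    x, then line j moves, with line i already at y. Hence the mixture of x and y. *)
Definition slope x y (ij : nat * nat) (n : nat) : C :=
  let: (i, j) := ij in
  let sx := slope4 (chord_cross x ij 0) (chord_cross y ij 0) in
  let sy := slope4 (chord_cross x ij 1) (chord_cross y ij 1) in
  let sz := slope4 (chord_cross x ij (-1)) (chord_cross y ij (-1)) in
  if n == i.*2 then sz * pcoord x j.*2.+1 - sy else
  if n == i.*2.+1 then sx - sz * pcoord x j.*2 else
  if n == j.*2 then sy - sz * pcoord y i.*2.+1 else
  if n == j.*2.+1 then sz * pcoord y i.*2 - sx else 0.

Lemma in_slope rep x y ij n : chord_ok ij ->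
  near_center (center_point rep) box_radius x ->
  near_center (center_point rep) box_radius y ->
  in_ball prec (slope x y ij n)
    (slope_entry n ij (chord_slopes rep radius ij)).
Proof.
move=> ok xb yb.
have xc k : (k < 14)%N -> in_ball prec (pcoord x k) (center rep radius k).
  by move=> k14; apply: in_box.
have yc k : (k < 14)%N -> in_ball prec (pcoord y k) (center rep radius k).
  by move=> k14; apply: in_box.
have [] := in_chord_point ok xc; have [] := in_chord_point ok yc.
rewrite /chord_slopes /slope.
case: ij ok => i j ok.
case: (chord_point rep radius (i, j)) => [[X Y] Z] /= y1 y2 y3 x1 x2 x3.
have P0 : Z.le 0 prec by [].
have sx := in_bcube4 P0 x1 y1.
have sy := in_bcube4 P0 x2 y2.
have sz := in_bcube4 P0 x3 y3.
have [i0 i1 j0 j1] := double_bound ok.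
do 4![case: ifP => _; first by apply: in_bsub => //; apply: in_bmul => //; auto].
exact: in_bzero.
Qed.

Lemma sum_indicator n (a : nat) (f : nat -> C) (e : C) : (a < n)%N ->
  \sum_(k < n) (if k == a :> nat then e else 0) * f k = e * f a.
Proof.
move=> an; rewrite (bigD1 (Ordinal an)) //= eqxx big1 ?addr0 // => k.
by rewrite -val_eqE /= => /negPf->; rewrite mul0r.
Qed.

Lemma slopeE x y ij : chord_ok ij ->
  qeval (@fermat _) (chord_cross x ij) - qeval (@fermat _) (chord_cross y ij) =
  \sum_(n < 14) slope x y ij n * (pcoord x n - pcoord y n).
Proof.
case: ij => i j ok; have [i0 i1 j0 j1] := double_bound ok.
rewrite !qeval_fermat.
have -> (a b c a' b' c' : C) : a ^+ 4 + b ^+ 4 + c ^+ 4 - (a' ^+ 4 + b' ^+ 4 + c' ^+ 4)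
   = slope4 a a' * (a - a') + slope4 b b' * (b - b') + slope4 c c' * (c - c').
  by rewrite -!slope4E; ring.
rewrite /slope; set sx := slope4 _ _; set sy := slope4 _ _; set sz := slope4 _ _.
have [-> -> ->] := chord_crossE x (i, j); have [-> -> ->] := chord_crossE y (i, j).
pose e a (v : C) (n : nat) : C := if n == a then v else 0.
transitivity (\sum_(n < 14)
   (e i.*2 (sz * pcoord x j.*2.+1 - sy) n * (pcoord x n - pcoord y n) +
    e i.*2.+1 (sx - sz * pcoord x j.*2) n * (pcoord x n - pcoord y n) +
    e j.*2 (sy - sz * pcoord y i.*2.+1) n * (pcoord x n - pcoord y n) +
    e j.*2.+1 (sz * pcoord y i.*2 - sx) n * (pcoord x n - pcoord y n))).
  rewrite !big_split /= /e.
  rewrite !(sum_indicator (fun n => pcoord x n - pcoord y n)) //=; ring.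
apply: eq_bigr => n _; rewrite -!mulrDl; congr (_ * _); rewrite /e.
have ij : (i < j)%N by case/andP: ok.
have d1 : (i.*2 == i.*2.+1) = false by lia.
have d2 : (i.*2 == j.*2) = false by lia.
have d3 : (i.*2 == j.*2.+1) = false by lia.
have d4 : (i.*2.+1 == j.*2) = false by lia.
have d5 : (i.*2.+1 == j.*2.+1) = false by lia.
have d6 : (j.*2 == j.*2.+1) = false by lia.
have [->|_] := eqVneq (n : nat) i.*2; first by rewrite d1 d2 d3 !addr0.
have [->|_] := eqVneq (n : nat) i.*2.+1; first by rewrite d4 d5 !addr0 add0r.
have [->|_] := eqVneq (n : nat) j.*2; first by rewrite d6 !addr0 !add0r.
by rewrite !add0r.
Qed.

Definition matrix_of (M : seq (seq (Z * Z))) : 'M[C]_14 :=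
  \matrix_(i, k) (zc R (nth (Z0, Z0) (nth [::] M i) k).1
                       (nth (Z0, Z0) (nth [::] M i) k).2 / (zr R (Z.pow 2 mprec))%:C).

Let t : R := zr R (Z.pow 2 mprec).

Lemma mscale_gt0 : 0 < t. Proof. by apply: zr2k_gt0. Qed.

Lemma mscaleC_neq0 : t%:C != 0 :> C.
Proof. by rewrite gt_eqF // ltcR mscale_gt0. Qed.

Lemma in_bdot M (v : 'cV[C]_14) (b : seq ball) i :
  (forall k : 'I_14, in_ball prec (v k 0) (nth bzero b k)) ->
  in_ball prec (t%:C * (matrix_of M *m v) i 0) (bdot (nth [::] M i) b).
Proof.
move=> vb; rewrite mxE mulr_sumr.
pose f (k : nat) : C := zc R (nth (Z0, Z0) (nth [::] M i) k).1
  (nth (Z0, Z0) (nth [::] M i) k).2 * v (inord k) 0.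
rewrite (eq_bigr (fun k : 'I_14 => f k)); last first.
  move=> k _; rewrite mxE /f inord_val -/t mulrA [t%:C * _]mulrC.
  by rewrite divfK ?mscaleC_neq0.
apply: in_bsum => k k14; apply: in_gscale.
by have := vb (inord k); rewrite inordK.
Qed.

Lemma one_scale : zr R scaled_one = s * t.
Proof. by rewrite /s /t -zrM. Qed.

Lemma check_newtonP rep M (i : 'I_14) : check_newton rep M ->
  check_row (slope_columns rep radius)
    [seq chord_value rep ij | ij <- chords] i (nth [::] M i).
Proof. by move=> /allP; apply; rewrite mem_iota ltn_ord. Qed.

Lemma zr_sum (I : Type) (r : seq I) (f : I -> Z) :
  zr R (foldr (fun j b => Z.add (f j) b) Z0 r) = \sum_(j <- r) zr R (f j).
Proof.
elim: r => [|j r IH] /=; first by rewrite big_nil zr0.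
by rewrite big_cons zrD IH.
Qed.

Lemma slope_columnsE rep rho n k : (n < 14)%N -> (k < 14)%N ->
  nth bzero (nth [::] (slope_columns rep rho) n) k =
  slope_entry n (chord k) (chord_slopes rep rho (chord k)).
Proof.
move=> n14 k14; rewrite /slope_columns (nth_map 0%N) ?size_iota // nth_iota // add0n.
rewrite (nth_map ((0%N, 0%N), (bzero, bzero, bzero, bzero))) ?size_map //.
by rewrite (nth_map (0%N, 0%N)) ?size_map.
Qed.

(** The balls of [slope_columns] enclose the divided differences for all x and y in the box at once,
    so one integer check covers every pair. *)
Lemma check_newton_jacobian rep M x y : check_newton rep M ->
  near_center (center_point rep) box_radius x ->
  near_center (center_point rep) box_radius y ->
  exists2 S : 'M[C]_14,
    chord_map (@fermat _) x - chord_map (@fermat _) y = S *m (x - y) &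
    forall i, \sum_j `|(1%:M - matrix_of M *m S) i j| <= (3 / 8)%:C.
Proof.
move=> chk xb yb; pose S : 'M[C]_14 := \matrix_(k, n) slope x y (chord k) n.
exists S.
  apply/colP => k; rewrite !mxE slopeE ?chord_okP //.
  by apply: eq_bigr => n _; rewrite !mxE /pcoord !inord_val.
move=> i; have /andP[+ _] := check_newtonP i chk.
set g := fun j : nat => bnorm (bsub (if i == j :> nat then (scaled_one, Z0, Z0) else bzero)
  (bdot (nth [::] M i) (nth [::] (slope_columns rep radius) j))).
rewrite -(zr_le R) zrM zrM zr_sum one_scale zr8 zr3.
move=> le_g.
have st0 : 0 < s * t by rewrite mulr_gt0 ?scale_gt0 ?mscale_gt0.
have gP (j : 'I_14) : (s * t)%:C * `|(1%:M - matrix_of M *m S) i j| <= (zr R (g j))%:C.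
  rewrite -[(s * t)%:C]ger0_norm ?ler0c ?(ltW st0) // -normrM rmorphM -mulrA.
  rewrite /g; apply: (@in_bnorm R prec).
  have -> : (1%:M - matrix_of M *m S) i j =
      (1%:M : 'M_14) i j - (matrix_of M *m S) i j.
    by rewrite [LHS]mxE [X in _ + X]mxE.
  rewrite mulrBr; apply: in_bsub.
    rewrite mxE -val_eqE; case: (_ == _); last by rewrite mulr0; apply: in_bzero.
    by rewrite mulr1 /in_ball /= -rmorphM -one_scale /zc zr0 subrr normr0.
  have -> : (matrix_of M *m S) i j = (matrix_of M *m col j S) i 0.
    by rewrite !mxE; apply: eq_bigr => k _; rewrite !mxE.
  apply: in_bdot => k; rewrite !mxE slope_columnsE ?ltn_ord //.
  by apply: in_slope => //; apply: chord_okP.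
have stC : 0 < (s * t)%:C :> C by rewrite ltcR.
rewrite -(ler_pM2l stC) mulr_sumr; apply: le_trans (ler_sum _ (fun j _ => gP j)) _.
rewrite -rmorphM -rmorph_sum lecR.
rewrite -(big_mkord xpredT (fun j => zr R (g j))) /index_iota subn0.
lra.
Qed.

Lemma check_newton_residual rep M i : check_newton rep M ->
  `|(matrix_of M *m chord_map (@fermat _) (center_point rep)) i 0| <=
     (3 / 8 * box_radius)%:C.
Proof.
move=> /(check_newtonP i)/andP[_].
set vals := map _ _; rewrite -(zr_le R) zrM zrM zr8 zr3.
have -> : Z.shiftl radius mprec = Z.mul radius (Z.pow 2 mprec) by [].
rewrite zrM -/t.
set w := (_ *m _) i 0.
have : in_ball prec (t%:C * w) (bdot (nth [::] M i) vals).
  apply: in_bdot => k; rewrite mxE (nth_map (0%N, 0%N)) //.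
  by apply: in_chord_value; apply: chord_okP.
move=> /in_bnorm; rewrite -/s mulrA -rmorphM normrM.
have st0 : 0 < s * t by rewrite mulr_gt0 ?scale_gt0 ?mscale_gt0.
have [a a0 ->] := norm_complexE w.
rewrite [`|_%:C|]ger0_norm ?ler0c ?(ltW st0) // -rmorphM !lecR => le1 le2.
rewrite /box_radius -(ler_pM2l st0).
have -> : s * t * (3 / 8 * (zr R radius / s)) = 3 / 8 * (zr R radius * t).
  by field; rewrite gt_eqF ?scale_gt0.
lra.
Qed.

Lemma representative_solution rep M : check_newton rep M ->
  exists2 eps : R, 0 < eps & forall c,
    (forall m, m \in (quartic_monomials : seq _) -> `|c m - fermat _ m| <= eps%:C) ->
    exists2 x, near_center (center_point rep) box_radius x &
      forall k : 'I_14, qeval c (chord_cross x (chord k)) = 0.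
Proof.
move=> chk; have r0 : 0 < box_radius by rewrite divr_gt0 ?scale_gt0 // -(zr0 R) zr_lt.
(* 1/8 is what the contraction factor leaves to the perturbation, and [box_radius / 8] what the
   first step leaves. *)
pose a := Num.min (1 / 8) (box_radius / 8).
have a0 : 0 < a by rewrite lt_min; apply/andP; split; [lra|rewrite divr_gt0].
have [eps eps0 epsP] := perturbation_small (center_point rep) box_radius (matrix_of M) a0.
exists eps => // c cP; pose g m := c m - fermat _ m.
have cE x : chord_map c x = chord_map (@fermat _) x + chord_map g x.
  apply/colP => k; rewrite !mxE -qevalD /qeval.
  by apply: eq_bigr => m _; rewrite /g addrC subrK.
have [x y xb yb|x y d xb yb xyd i|i|x xb x0] := @newton_perturbed R _ (center_point rep) box_radius
    (matrix_of M) (chord_map (@fermat _)) (chord_map g) (ltW r0).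
- exact: check_newton_jacobian chk xb yb.
- have [_ h2] := epsP g cP x y d xb yb xyd i.
  apply: le_trans h2 _; rewrite lecR [d / 8]mulrC ler_wpM2r ?(near_dist_ge0 xyd) //.
  by rewrite -div1r ge_min lexx.
- rewrite mulmxDr mxE; apply: le_trans (ler_normD _ _) _.
  have cb : near_center (center_point rep) box_radius (center_point rep).
    by move=> j; rewrite subrr normr0 ler0c ltW.
  have zb j : `|center_point rep j 0 - center_point rep j 0| <= (0 : R)%:C.
    by rewrite subrr normr0.
  have [h1 _] := epsP g cP _ _ 0 cb cb zb i.
  apply: le_trans (lerD (check_newton_residual i chk) h1) _.
  have : a <= box_radius / 8 by rewrite ge_min lexx orbT.
  by rewrite -rmorphD lecR; lra.
exists x => // k; move: x0; rewrite -cE => /colP/(_ k).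
by rewrite !mxE.
Qed.

Lemma chart_det x i j k : 
  dot (cross (chart_line x i) (chart_line x j)) (chart_line x k) =
  chord_cross x (i, j) 0 * pcoord x k.*2 + chord_cross x (i, j) 1 * pcoord x k.*2.+1
  + chord_cross x (i, j) (-1).
Proof. by rewrite dotE /chord_cross /= {3 6 9}/chart_line /= mulr1. Qed.

Lemma check_generic_det rep x (i j k : 'I_7) : check_generic rep ->
  near_center (center_point rep) box_radius x -> i != j -> i != k -> j != k ->
  dot (cross (chart_line x i) (chart_line x j)) (chart_line x k) != 0.
Proof.
move=> chk xb.
have lt_case (a b c : 'I_7) : (a < b)%N -> (b < c)%N ->
    dot (cross (chart_line x a) (chart_line x b)) (chart_line x c) != 0.
  move=> ab bc; have b7 := ltn_ord b; have c7 := ltn_ord c.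
  have nz : bnonzero (det3 rep a b c).
    move/allP: chk => /(_ a); rewrite mem_iota ltn_ord => /(_ isT)/allP/(_ b).
    rewrite mem_iota => /(_ ltac:(lia))/allP/(_ c).
    by rewrite mem_iota; apply; lia.
  have xc n : (n < 14)%N -> in_ball prec (pcoord x n) (center rep radius n).
    by move=> n14; apply: in_box.
  have ok : chord_ok (a : nat, b : nat) by rewrite /chord_ok /= ab b7.
  have [] := in_chord_point ok xc.
  rewrite chart_det; move: nz; rewrite /det3.
  case: (chord_point _ _ _) => [[X Y] Z] /= nz x1 x2 x3; apply: in_bnonzero nz.
  apply: (in_badd _ x3); apply: in_badd.
    by apply: (in_bmul _ x1) => //; apply: xc; lia.
  by apply: (in_bmul _ x2) => //; apply: xc; lia.
(* Only increasing triples were checked; rotations and swaps reach the other orders. *)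
have rot (a b c : 'I_7) :
    dot (cross (chart_line x a) (chart_line x b)) (chart_line x c) != 0 ->
    dot (cross (chart_line x b) (chart_line x c)) (chart_line x a) != 0.
  by rewrite det_rot.
have swap (a b c : 'I_7) :
    dot (cross (chart_line x a) (chart_line x b)) (chart_line x c) != 0 ->
    dot (cross (chart_line x b) (chart_line x a)) (chart_line x c) != 0.
  by rewrite det_swap oppr_eq0.
rewrite -!val_eqE !neq_ltn => /orP[ij|ij] /orP[ik|ik] /orP[jk|jk]; try by lia.
- exact: lt_case.
- by apply/swap/rot/rot/lt_case.
- by apply/rot/lt_case.
- by apply/swap/lt_case.
- by apply/rot/rot/lt_case.
- by apply/swap/rot/lt_case.
Qed.

End Certificate.

(** * The monomial group *)

Section LineEquality.

Variable K : fieldType.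
Implicit Types u v w : 'I_3 -> K.

Definition lines_neq v w := [exists k, cross v w k != 0].

Lemma lines_neqPn v w :
  ~~ lines_neq v w <-> forall a b, v a * w b = v b * w a.
Proof.
split=> [/existsPn nvw|vw]; last first.
  by apply/existsPn => k; rewrite negbK /cross vw subrr.
have c k : v (k + 1) * w (k - 1) = v (k - 1) * w (k + 1).
  by apply/eqP; rewrite -subr_eq0; have := nvw k; rewrite negbK.
have c0 := c 0; have c1 := c 1; have c2 := c (-1).
rewrite add0r sub0r in c0; rewrite ord3_1D1 subrr in c1; rewrite addNr ord3_N1B1 in c2.
by move=> a; move: a; apply: ord3E; apply: ord3E.
Qed.

End LineEquality.

(** Every permutation of Z/3 is affine, so t and s describe all six. *)
Definition affine3 (t : 'I_3) (s : bool) (k : 'I_3) : 'I_3 := if s then t - k else t + k.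

Definition affine3_inv (t : 'I_3) (s : bool) (k : 'I_3) : 'I_3 := if s then t - k else k - t.

Lemma affine3K t s : cancel (affine3 t s) (affine3_inv t s).
Proof. by move=> k; rewrite /affine3 /affine3_inv; case: s; rewrite ?subKr // addrC addKr. Qed.

Lemma affine3_invK t s : cancel (affine3_inv t s) (affine3 t s).
Proof. by move=> k; rewrite /affine3 /affine3_inv; case: s; rewrite ?subKr // addrC subrK. Qed.

Lemma affine3_comp t s t' s' k :
  affine3 t' s' (affine3_inv t s k) =
  affine3 (if s (+) s' then t' + t else t' - t) (s (+) s') k.
Proof. by rewrite /affine3 /affine3_inv; case: s; case: s' => /=; ring. Qed.

Section MonomialAction.

Variable R : realType.
Notation C := R[i].
Notation I := ('i%C : C).
Implicit Types v w : 'I_3 -> C.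

Lemma I4 : I ^+ 4 = 1.
Proof.
apply/eqP; rewrite eq_complex /= !(mulr0, mul0r, mulr1, mul1r, subr0, sub0r).
by rewrite !(addr0, add0r, mulNr, mulrN, opprK, oppr0) !eqxx.
Qed.

Lemma I_neq0 : I != 0.
Proof. by apply/eqP => /eqP; rewrite eq_complex /= oner_eq0 andbF. Qed.

Lemma I_norm : `|I| = 1.
Proof. by rewrite normc_def /= expr0n expr1n add0r sqrtr1. Qed.

Lemma I_mod4 n : I ^+ (n %% 4) = I ^+ n.
Proof. by rewrite {2}(divn_eq n 4) exprD mulnC exprM I4 expr1n mul1r. Qed.

(** Exponents 3n play the role of -n, which keeps all exponents natural. *)
Lemma I3 n : I ^+ n * I ^+ (3 * n) = 1.
Proof. by rewrite -exprD -mulSn exprM I4 expr1n. Qed.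

Definition gact (e : 'I_3 -> nat) t s v : 'I_3 -> C :=
  fun k => I ^+ e k * v (affine3 t s k).

(** Cross products transform by the cofactor matrix: the determinant, a sign times a power of i, and
    the inverse diagonal. *)
Lemma cross_gact e t s v w k :
  cross (gact e t s v) (gact e t s w) k =
  ((-1) ^+ s * I ^+ (e 0%R + e 1%R + e (-1)%R)%N) *
    (I ^+ (3 * e k) * cross v w (affine3 t s k)).
Proof.
rewrite mulrA -[_ * I ^+ (3 * _)]mulrA.
have -> : I ^+ (e 0%R + e 1%R + e (-1)%R)%N * I ^+ (3 * e k) = I ^+ (e (k + 1)%R + e (k - 1)%R)%N.
  have -> : (e 0%R + e 1%R + e (-1)%R = e k + (e (k + 1)%R + e (k - 1)%R))%N.
    move: k; apply: ord3E; rewrite ?ord3_1D1 ?ord3_N1B1 ?add0r ?sub0r ?subrr ?addNr.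
    - by rewrite addnA.
    - by rewrite -addnA addnC -addnA.
    - by rewrite addnC.
  by rewrite [in LHS]exprD mulrAC I3 mul1r.
rewrite /cross /gact exprD.
have -> : affine3 t s (k + 1) = if s then affine3 t s k - 1 else affine3 t s k + 1.
  by rewrite /affine3; case: s; ring.
have -> : affine3 t s (k - 1) = if s then affine3 t s k + 1 else affine3 t s k - 1.
  by rewrite /affine3; case: s; ring.
by case: s; rewrite ?expr1 ?expr0; ring.
Qed.

Lemma det_gact e t s u v w :
  dot (cross u v) w != 0 ->
  dot (cross (gact e t s u) (gact e t s v)) (gact e t s w) != 0.
Proof.
have -> : dot (cross (gact e t s u) (gact e t s v)) (gact e t s w) =
   ((-1) ^+ s * I ^+ (e 0%R + e 1%R + e (-1)%R)%N) * dot (cross u v) w.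
  rewrite {2}/dot (reindex_inj (can_inj (affine3K t s))) /= mulr_sumr.
  apply: eq_bigr => k _; rewrite cross_gact /gact -!mulrA; congr (_ * (_ * _)).
  by rewrite mulrCA [X in _ * X]mulrA [X in _ * (X * _)]mulrC I3 mul1r.
by move=> d0; rewrite !mulf_neq0 ?expf_neq0 ?oppr_eq0 ?oner_eq0 ?I_neq0.
Qed.

Definition mperm3 (f : 'I_3 -> 'I_3) (m : 'X_{1..3}) : 'X_{1..3} := [multinom m (f k) | k < 3].

Lemma mdeg_mperm3 f m : injective f -> mdeg (mperm3 f m) = mdeg m.
Proof.
move=> fI; rewrite !mdegE [RHS](reindex_inj fI) /=.
by apply: eq_bigr => k _; rewrite mnmE.
Qed.

Lemma qeval_monomial (f g : 'I_3 -> 'I_3) (c : 'X_{1..3} -> C) u (w P : 'I_3 -> C) :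
  cancel f g -> cancel g f ->
  qeval c (fun k => u * (w k * P (f k))) =
  u ^+ 4 * qeval (fun m => c (mperm3 f m) * \prod_k w k ^+ m (f k)) P.
Proof.
move=> fK gK; have fI := can_inj fK; have gI := can_inj gK.
have mK : cancel (mperm3 f) (mperm3 g).
  by move=> m; apply/mnmP => k; rewrite !mnmE gK.
have perm : perm_eq (quartic_monomials : seq _) (map (mperm3 f) quartic_monomials).
  apply: uniq_perm; rewrite ?(map_inj_uniq (can_inj mK)) ?quartic_monomials_uniq //.
  move=> m; rewrite mem_quartic_monomials; apply/idP/mapP => [m4|[m' + ->]].
    exists (mperm3 g m); first by rewrite mem_quartic_monomials mdeg_mperm3.
    by apply/mnmP => k; rewrite !mnmE fK.
  by rewrite mem_quartic_monomials mdeg_mperm3.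
rewrite /qeval (perm_big _ perm) big_map mulr_sumr big_seq [RHS]big_seq.
apply: eq_bigr => m; rewrite mem_quartic_monomials => /eqP m4.
have -> : u ^+ 4 = \prod_k u ^+ m (f k).
  by rewrite prodrXr; congr (_ ^+ _); have := m4; rewrite mdegE (reindex_inj fI) => /esym.
rewrite mulrCA -!mulrA; congr (_ * _).
rewrite mulrCA [X in _ * (_ * X)](reindex_inj fI) /= -!big_split /=.
by apply: eq_bigr => k _; rewrite mnmE !exprMn mulrCA.
Qed.

(** The quartic pulled back along the map that [gact] induces on intersection points; points move
    contragrediently to lines, whence the exponents 3e. *)
Definition twist e t s (c : 'X_{1..3} -> C) (m : 'X_{1..3}) : C :=
  c (mperm3 (affine3 t s) m) * \prod_k (I ^+ (3 * e k)) ^+ m (affine3 t s k).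

Lemma qeval_gact e t s c v w :
  qeval (twist e t s c) (cross v w) = 0 ->
  qeval c (cross (gact e t s v) (gact e t s w)) = 0.
Proof.
move=> q0; pose u := (-1) ^+ s * I ^+ (e 0%R + e 1%R + e (-1)%R)%N.
have -> : qeval c (cross (gact e t s v) (gact e t s w)) =
    qeval c (fun k => u * (I ^+ (3 * e k) * cross v w (affine3 t s k))).
  by apply: eq_bigr => m _; congr (_ * _); apply: eq_bigr => k _; rewrite cross_gact.
by rewrite (qeval_monomial _ _ _ _ (@affine3K t s) (@affine3_invK t s)) q0 mulr0.
Qed.

(** Twisting permutes the coefficients up to factors of modulus 1 and fixes those of the Fermat
    quartic because i^4 = 1. *)
Lemma twist_near_fermat e t s c (eps : R) :
  (forall m, m \in (quartic_monomials : seq _) -> `|c m - fermat _ m| <= eps%:C) ->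
  forall m, m \in (quartic_monomials : seq _) -> `|twist e t s c m - fermat _ m| <= eps%:C.
Proof.
move=> cP m mq; set f := affine3 t s.
have fI : injective f := can_inj (@affine3K t s).
set W := \prod_k (I ^+ (3 * e k)) ^+ m (f k).
have fE : fermat C (mperm3 f m) = fermat C m.
  rewrite /fermat; congr (nat_of_bool _)%:R.
  apply/existsP/existsP => -[k]; rewrite ?mnmE => mk; first by exists (f k).
  by exists (affine3_inv t s k); rewrite mnmE /f affine3_invK.
have WE : W * fermat C m = fermat C m.
  rewrite /fermat; case: existsP => [[k /eqP mk]|_]; last by rewrite mulr0.
  rewrite mulr1 /W (bigD1 (affine3_inv t s k)) //= /f affine3_invK mk.
  rewrite exprAC I4 expr1n mul1r big1 // => j jk.
  (* In degree 4, an exponent 4 leaves nothing for the other coordinates. *)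
  suff -> : m (affine3 t s j) = 0%N by rewrite expr0.
  move: mq; rewrite mem_quartic_monomials mdegE (bigD1 k) //= mk.
  rewrite -[X in _ == X]addn0 eqn_add2l sum_nat_eq0 => /forallP/(_ (affine3 t s j)).
  have -> : affine3 t s j != k.
    by apply: contraNneq jk => <-; rewrite affine3K.
  by move/eqP.
have W1 : `|W| = 1.
  by rewrite /W normr_prod big1 // => k _; rewrite !normrX I_norm !expr1n.
rewrite /twist -/f -/W -WE -fE mulrC -mulrBr normrM W1 mul1r; apply: cP.
by rewrite mem_quartic_monomials mdeg_mperm3 // -mem_quartic_monomials.
Qed.

End MonomialAction.

(** * Separation of the 864 heptagons *)

Lemma certificate_separation : check_sep.
Proof. by vm_cast_no_check (erefl true). Qed.

Section Separation.

Variable R : realType.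
Notation C := R[i].
Notation I := ('i%C : C).
Implicit Types (v w : 'I_3 -> C) (V W : seq ball).

Definition ball_vec V v := forall k : 'I_3, in_ball sprec (v k) (nth bzero V k).

Lemma in_brot P (z : C) A : in_ball P z A -> in_ball P (I * z) (brot A).
Proof.
case: A => [[a b] r]; rewrite /in_ball /= => zA.
have -> : zc R (Z.opp b) a = I * zc R a b.
  have -> : zc R (Z.opp b) a = Complex (- zr R b) (zr R a).
    by rewrite /zc -[Z.opp b]/(Z.sub Z0 b) zrB zr0 sub0r.
  by apply/eqP; rewrite eq_complex /= !(mul0r, mul1r, sub0r, add0r) !eqxx.
by rewrite mulrCA -mulrBr normrM I_norm mul1r.
Qed.

Lemma in_iter_brot P (z : C) A n : in_ball P z A -> in_ball P (I ^+ n * z) (iter n brot A).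
Proof.
move=> zA; elim: n => [|n IH]; first by rewrite expr0 mul1r.
by rewrite exprS -mulrA iterS; apply: in_brot.
Qed.

Lemma affine3_val (t : 'I_3) s (k : 'I_3) :
  affine3 t s k = ((if s then t + (3 - k) else t + k) %% 3)%N :> nat.
Proof. by move: t k; apply: ord3E; apply: ord3E; case: s. Qed.

Definition exps3 (e0 e1 : nat) (k : 'I_3) : nat :=
  if k == 0 then e0 else if k == 1 then e1 else 0%N.

Lemma ball_vec_bact e0 e1 (t : 'I_3) s V v :
  ball_vec V v -> ball_vec (bact e0 e1 t s V) (gact (exps3 e0 e1) t s v).
Proof.
move=> vV k.
have wk (j : nat) : k = j :> nat -> in_ball sprec (v (affine3 t s k))
    (nth bzero V ((if s then t + (3 - j) else t + j)%N %% 3)%N).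
  by move=> kj; rewrite -kj -affine3_val; apply: vV.
by move: k wk; apply: ord3E => wk; rewrite /gact /exps3 /=;
  do ?[apply: in_iter_brot]; rewrite ?expr0 ?mul1r; apply: wk.
Qed.

Lemma lines_differP V W v w :
  ball_vec V v -> ball_vec W w -> lines_differ V W -> lines_neq v w.
Proof.
move=> vV wW.
have nz (i j k : 'I_3) : cross v w k = v i * w j - v j * w i ->
    bnonzero (bsub (bmul sprec (nth bzero V i) (nth bzero W j))
                   (bmul sprec (nth bzero V j) (nth bzero W i))) -> lines_neq v w.
  move=> ck nz; apply/existsP; exists k; rewrite ck; apply: in_bnonzero nz.
  by apply: in_bsub; apply: in_bmul.
rewrite /lines_differ /= orbF => /or3P[].
- by apply: (nz 1 (-1) 0); apply: cross0.
- by apply: (nz (-1) 0 1); apply: cross1.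
- by apply: (nz 0 1 (-1)); apply: cross2.
Qed.

Lemma in_coarse P k (z : C) A : Z.le 0 P -> Z.le 0 k ->
  in_ball (Z.add P k) z A -> in_ball P z (bround k A).
Proof.
case: A => [[a b] r] P0 k0; rewrite /in_ball /= Z.pow_add_r // zrM => zA.
have k1 : (zr R (Z.pow 2 k))%:C != 0 :> C by rewrite gt_eqF // ltcR zr2k_gt0.
have := in_bround k0 zA; rewrite rmorphM /=.
by rewrite mulrAC mulfK.
Qed.

Lemma ball_vec_coarse rep (x : 'cV[C]_14) (i : 'I_7) :
  near_center (center_point R rep) (box_radius R) x ->
  ball_vec (coarse rep i) (chart_line x i).
Proof.
move=> xb.
have c n : (n < 14)%N -> in_ball sprec (pcoord x n) (bround 24 (center rep radius n)).
  by move=> n14; apply: in_coarse => //; apply: in_box.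
have i7 := ltn_ord i.
apply: ord3E; rewrite /chart_line /=.
- by apply: c; lia.
- by apply: c; lia.
- by rewrite /in_ball /= mulr1 /zc zr0 subrr normr0.
Qed.

Lemma check_sepP (r r' : 'I_9) (e0 e1 : 'I_4) (t : 'I_3) (s : bool) x y :
  (r <= r')%N ->
  ~~ [&& r == r', e0 == 0, e1 == 0, t == 0 & ~~ s] ->
  near_center (center_point R (nth [::] reps r)) (box_radius R) x ->
  near_center (center_point R (nth [::] reps r')) (box_radius R) y ->
  exists i : 'I_7, forall j : 'I_7,
    lines_neq (chart_line x i) (gact (exps3 e0 e1) t s (chart_line y j)).
Proof.
move=> rr' nid xb yb.
pose cs := [seq [seq coarse rep i | i <- iota 0 7] | rep <- reps].
have sz n : (n < 9)%N -> nth [::] cs n = [seq coarse (nth [::] reps n) i | i <- iota 0 7].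
  by move=> n9; rewrite (nth_map [::]).
have : separatedb (nth [::] cs r) (map (bact e0 e1 t s) (nth [::] cs r')).
  have /allP/(_ r) := certificate_separation; rewrite mem_iota ltn_ord => /(_ isT)/allP/(_ r').
  have r'9 := ltn_ord r'.
  rewrite mem_iota rr' (_ : (r' < r + (9 - r))%N) => [|]; last by lia.
  move=> /(_ isT)/allP/(_ e0); rewrite mem_iota ltn_ord => /(_ isT)/allP/(_ e1).
  rewrite mem_iota ltn_ord => /(_ isT)/allP/(_ t).
  rewrite mem_iota ltn_ord => /(_ isT)/allP/(_ s).
  have sin : s \in [:: false; true] by rewrite !inE; case: (s).
  move=> /(_ sin).
  case/orP=> // id; case/negP: nid; move: id => /and5P[rr e00 e10 t0 ->].
  by rewrite -!val_eqE /= rr e00 e10 t0.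
clearbody cs; rewrite (sz r (ltn_ord r)) (sz r' (ltn_ord r')) => /hasP[_ /mapP[i + ->]].
rewrite mem_iota => /andP[_ i7] /allP sep.
exists (Ordinal i7) => j; apply: lines_differP (ball_vec_coarse _ xb) _ _.
  by apply: ball_vec_bact; apply: ball_vec_coarse yb.
by apply: sep; apply: map_f; apply: map_f; rewrite mem_iota ltn_ord.
Qed.

End Separation.

Section Indexing.

Variable R : realType.
Notation C := R[i].
Notation I := ('i%C : C).

(* k < 864 = 9 * 4 * 4 * 3 * 2 encodes an orbit, the exponents of i on the     *)
(* first two coordinates, and a permutation c |-> t + c or c |-> t - c of Z/3. *)
Definition rep_of (k : nat) := (k %/ 96)%N.
Lemma rep_of_lt (k : 'I_864) : (rep_of k < 9)%N.
Proof. by rewrite /rep_of ltn_divLR //; apply: ltn_ord. Qed.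

Definition exp0_of (k : nat) := (k %/ 24 %% 4)%N.
Definition exp1_of (k : nat) := (k %/ 6 %% 4)%N.
Definition shift_of (k : nat) : 'I_3 := inord (k %/ 2 %% 3).
Definition flip_of (k : nat) : bool := odd k.

Lemma index_inj k l : rep_of k = rep_of l -> exp0_of k = exp0_of l ->
  exp1_of k = exp1_of l -> shift_of k = shift_of l -> flip_of k = flip_of l -> k = l.
Proof.
rewrite /rep_of /exp0_of /exp1_of /flip_of => rE e0E e1E + sE.
move=> /(congr1 val); rewrite /= !inordK ?ltn_mod // => tE.
lia.
Qed.

Definition index_act (k : nat) : ('I_3 -> C) -> 'I_3 -> C :=
  gact (exps3 (exp0_of k) (exp1_of k)) (shift_of k) (flip_of k).

(** Here [d] holds the exponents of g^-1 g' and [h] the same shifted to make the last one 0; the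
    shift is a scalar, which does not move lines. *)
Lemma gact_relative e t s e' t' s' (v w : 'I_3 -> C) :
  let tau := affine3_inv t s in
  let d A := (e' (tau A) + 3 * e (tau A))%N in
  let h A := ((d A + 3 * d (-1)%R) %% 4)%N in
  ~~ lines_neq (gact e t s v) (gact e' t' s' w) ->
  ~~ lines_neq v (gact (exps3 (h 0) (h 1))
      (if s (+) s' then t' + t else t' - t) (s (+) s') w).
Proof.
move=> tau d h /lines_neqPn vw; apply/lines_neqPn => A B.
have h2 : h (-1) = 0%N by rewrite /h -mulSn modnMr.
have hE k : exps3 (h 0) (h 1) k = h k.
  by move: k; apply: ord3E; rewrite /exps3 //= h2.
have gE k : gact (exps3 (h 0) (h 1)) (if s (+) s' then t' + t else t' - t) (s (+) s') w k =
    I ^+ e' (tau k) * I ^+ (3 * e (tau k)) * I ^+ (3 * d (-1)%R) * w (affine3 t' s' (tau k)).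
  by rewrite /gact hE /h I_mod4 /d !exprD -affine3_comp.
rewrite !gE; move: (vw (tau A) (tau B)); rewrite /gact /tau !affine3_invK -/tau.
have := I3 R (e (tau A)); have := I3 R (e (tau B)).
move: (I ^+ (3 * d (-1)%R)) (I ^+ e (tau A)) (I ^+ e (tau B)) (I ^+ (3 * e (tau A)))
  (I ^+ (3 * e (tau B))) (I ^+ e' (tau A)) (I ^+ e' (tau B)) (w _) (w _) (v A) (v B).
move=> K a b a3 b3 a' b' wA wB vA vB bb aa eq_ab.
transitivity ((a * a3) * (vA * (b' * b3 * K * wB))); first by rewrite aa mul1r.
transitivity ((a * vA * (b' * wB)) * (a3 * b3 * K)); first by ring.
rewrite eq_ab; transitivity ((b * b3) * (vB * (a' * a3 * K * wA))); first by ring.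
by rewrite bb mul1r.
Qed.

Lemma exp_diff0_mod4 (a b k : nat) : (a < 4)%N -> (b < 4)%N -> (k %% 4 = 0)%N ->
  ((a + 3 * b + 3 * k) %% 4 = 0)%N -> a = b.
Proof. lia. Qed.

Lemma mul3_mod4 (k : nat) : ((0 + 3 * 0 + 3 * k) %% 4 = 0)%N -> (k %% 4 = 0)%N.
Proof. lia. Qed.

Lemma index_separated (k l : 'I_864) (x y : 'cV[C]_14) :
  (k < l)%N ->
  near_center (center_point R (nth [::] reps (rep_of k))) (box_radius R) x ->
  near_center (center_point R (nth [::] reps (rep_of l))) (box_radius R) y ->
  exists i : 'I_7, forall j : 'I_7,
    lines_neq (index_act k (chart_line x i)) (index_act l (chart_line y j)).
Proof.
move=> kl xb yb.
set e := exps3 (exp0_of k) (exp1_of k); set e' := exps3 (exp0_of l) (exp1_of l).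
set t := shift_of k; set t' := shift_of l; set s := flip_of k; set s' := flip_of l.
pose tau := affine3_inv t s.
pose d A := (e' (tau A) + 3 * e (tau A))%N.
pose h A := ((d A + 3 * d (-1)%R) %% 4)%N.
have h4 A : (h A < 4)%N by rewrite /h ltn_mod.
have k9 : (rep_of k < 9)%N := rep_of_lt k.
have l9 : (rep_of l < 9)%N := rep_of_lt l.
have [||||i sep] := @check_sepP R (Ordinal k9) (Ordinal l9) (Ordinal (h4 0)) (Ordinal (h4 1))
   (if s (+) s' then t' + t else t' - t) (s (+) s') x y.
- by apply: leq_div2r; apply: ltnW.
(* A trivial relative element within one orbit would mean that k and l encode the same data. *)
- apply/negP => /and5P[/eqP/(congr1 val) /= rE /eqP/(congr1 val) /= h0].
  move=> /eqP/(congr1 val) /= h1 tE sE.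
  have ss : s = s' by move: sE; case: (s); case: (s').
  have tt : t = t' by move: tE; rewrite ss addbb /= subr_eq0 => /eqP.
  have e4 a : (e a < 4)%N.
    by move: a; apply: ord3E; rewrite /e /exps3 /exp0_of /exp1_of //= ltn_mod.
  have e'4 a : (e' a < 4)%N.
    by move: a; apply: ord3E; rewrite /e' /exps3 /exp0_of /exp1_of //= ltn_mod.
  have hA A : h A = 0%N.
    by move: A; apply: ord3E; rewrite ?h0 ?h1 // /h -mulSn modnMr.
  (* Both elements have last exponent 0; reading [hA] at the image of the last coordinate shows that
     the normalising shift is trivial modulo 4. *)
  have d0 : (d (-1)%R %% 4 = 0)%N.
    have := hA (affine3 t s (-1)); rewrite /h {1}/d /tau affine3K -/tau.
    by rewrite /e /e' /exps3 /= => /mul3_mod4.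
  have ee a : e' a = e a.
    have := hA (affine3 t s a); rewrite /h {1}/d /tau affine3K -/tau.
    by apply: exp_diff0_mod4.
  have := ltnn k; rewrite {2}(@index_inj k l) ?kl //.
  + by have := ee 0.
  + by have := ee 1.
- exact: xb.
- exact: yb.
exists i => j; apply: contraTT (sep j) => nvw.
exact: gact_relative nvw.
Qed.

End Indexing.

(** * Genericity *)

Lemma certificate_newton :
  all (fun n => check_newton (nth [::] reps n) (nth [::] inverses n)) (iota 0 9).
Proof. by vm_cast_no_check (erefl true). Qed.

Lemma certificate_generic : all (fun n => check_generic (nth [::] reps n)) (iota 0 9).
Proof. by vm_cast_no_check (erefl true). Qed.

Lemma chordsP (i j : 'I_7) : (i < j)%N -> ~~ adjacent i j ->
  exists k : 'I_14, chord k = (i : nat, j : nat).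
Proof.
move=> ij nadj.
have ijc : (i : nat, j : nat) \in chords.
  by move: nadj ij; case: i => [[|[|[|[|[|[|[|//]]]]]]] i7];
     case: j => [[|[|[|[|[|[|[|//]]]]]]] j7].
have k14 : (index (i : nat, j : nat) chords < 14)%N by rewrite -index_mem in ijc.
by exists (Ordinal k14); rewrite /chord /= nth_index.
Qed.

Section Counting.

Variable R : realType.
Notation C := R[i].
Notation family n := ('I_n -> 'I_7 -> 'I_3 -> C).

(** Every clause is a finite combination of polynomial equations and inequations, hence first-order.
    The last compares lines regardless of their positions, so it excludes all relabellings at
    once. *)
Definition solution_family n (c : 'X_{1..3} -> C) (L : family n) : Prop :=
  [/\ forall k (i j l : 'I_7), i != j -> i != l -> j != l ->
        dot (cross (L k i) (L k j)) (L k l) != 0,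
      forall k (i j : 'I_7), (i < j)%N -> ~~ adjacent i j ->
        qeval c (cross (L k i) (L k j)) = 0
    & forall k l : 'I_n, (k < l)%N -> exists i, forall j, lines_neq (L k i) (L l j)].

(** The k-th heptagon for c is the image under the k-th group element of the one found in its box
    for the twist of c. *)
Lemma near_fermat_solutions : exists2 eps : R, 0 < eps & forall c,
  (forall m, m \in (quartic_monomials : seq _) -> `|c m - fermat _ m| <= eps%:C) ->
  exists L : family 864, solution_family c L.
Proof.
have rep_sol (r : 'I_9) : exists eps : R, 0 < eps /\ forall c,
    (forall m, m \in (quartic_monomials : seq _) -> `|c m - fermat _ m| <= eps%:C) ->
    exists2 x, near_center (center_point R (nth [::] reps r)) (box_radius R) x &
      forall k : 'I_14, qeval c (chord_cross x (chord k)) = 0.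
  have /allP/(_ r) := certificate_newton; rewrite mem_iota ltn_ord => /(_ isT).
  by move=> /(representative_solution R)[eps eps0 epsP]; exists eps.
have [eps epsP] := fin_all_exists rep_sol.
have eps0 r : 0 < eps r by have [] := epsP r.
(* Its inverse is a positive lower bound of the nine radii [eps r]. *)
pose sinv := \sum_r (eps r)^-1.
have sinvP r : (eps r)^-1 <= sinv.
  by rewrite /sinv (bigD1 r) //= lerDl sumr_ge0 // => i _; rewrite invr_ge0 ltW.
have sinv0 : 0 < sinv by apply: lt_le_trans (sinvP 0); rewrite invr_gt0.
exists sinv^-1 => [|c cP]; first by rewrite invr_gt0.
have r9 (k : 'I_864) : (rep_of k < 9)%N := rep_of_lt k.
have sol (k : 'I_864) : exists x : 'cV[C]_14,
    near_center (center_point R (nth [::] reps (rep_of k))) (box_radius R) x /\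
    forall j : 'I_14, qeval (twist (exps3 (exp0_of k) (exp1_of k)) (shift_of k) (flip_of k) c)
      (chord_cross x (chord j)) = 0.
  have [_ /(_ (twist (exps3 (exp0_of k) (exp1_of k)) (shift_of k) (flip_of k) c))] :=
    epsP (Ordinal (r9 k)).
  case=> [|x xb x0]; last by exists x.
  apply: twist_near_fermat => m /cP cm; apply: le_trans cm _.
  by rewrite lecR -[leRHS]invrK lef_pV2 ?posrE ?invr_gt0.
have [x xP] := fin_all_exists sol.
exists (fun (k : 'I_864) (i : 'I_7) => index_act k (chart_line (x k) i)); split.
- move=> k i j l ij il jl; apply: det_gact.
  have [xb _] := xP k; apply: check_generic_det xb ij il jl.
  have /allP/(_ (rep_of k)) := certificate_generic.
  by rewrite mem_iota r9; apply.
- move=> k i j ij nadj; apply: qeval_gact; have [_ x0] := xP k.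
  by have [m mE] := chordsP ij nadj; have := x0 m; rewrite mE.
- move=> k l kl; have [xb _] := xP k; have [yb _] := xP l.
  exact: index_separated kl xb yb.
Qed.

Lemma solution_family_heptagons n (q : {mpoly C[3]}) (L : family n) :
  quartic q -> solution_family (fun m => q@_m) L ->
  exists H : 'I_n -> 'Z_7 -> {vspace 'rV[C]_3},
      (forall k, heptagon (H k) /\ adjoint_curve (H k) q) /\
      (forall k l, k != l -> ~ same_heptagon (H k) (H l)).
Proof.
move=> qq [genL L0 sepL]; have [q0 hq] := qq.
exists (fun k i => line (L k i)); split=> [k|].
  split; first exact: heptagon_lines (genL k).
  apply: (adjoint_curve_lines (genL k) qq) => i j ij nadj.
  rewrite (meval_quartic _ hq).
  move: ij; rewrite -val_eqE neq_ltn => /orP[ij|ji]; first exact: L0.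
  (* Exchanging the two lines only multiplies the coordinates of their meet by -1. *)
  have q0' : qeval (fun m => q@_m) (cross (L k j) (L k i)) = 0.
    by apply: L0 => //; rewrite /adjacent orbC.
  rewrite -(meval_quartic _ hq) (meval_eq (v2 := fun a => -1 * cross (L k j) (L k i) a)).
    by rewrite (meval_dhomogZ _ _ hq) (meval_quartic _ hq) q0' mulr0.
  by move=> a; rewrite /cross; ring.
have sep (k l : 'I_n) : (k < l)%N -> exists i, forall j, line (L k i) <> line (L l j).
  by move=> /sepL[i iP]; exists i => j; have /existsP[a] := iP j; apply: line_neq.
move=> k l; rewrite -val_eqE neq_ltn => /orP[/sep[i iP]|/sep[i iP]] [a [e|e]].
- by case: (iP (i - a)); rewrite e addrC subrK.
- by case: (iP (a - i)); rewrite e subKr.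
- exact: iP (e i).
- exact: iP (e i).
Qed.

(** Variables 0 to 14 hold the coefficients of the quartic; each heptagon then takes 21 = 7 · 3
    variables. *)
Definition family_of_env n (e : seq C) : family n :=
  fun k i a => nth 0 e (15 + ((k * 7 + i) * 3 + a))%N.

Definition coeffs_of_env (e : seq C) (m : 'X_{1..3}) : C :=
  nth 0 e (index m quartic_monomials).

Definition has_family n (e : seq C) : Prop := exists2 e' : seq C,
  (forall i, i \notin iota 15 (n * 21) -> nth 0 e i = nth 0 e' i) &
  solution_family (coeffs_of_env e') (@family_of_env n e').

Lemma definable_has_family n : definable (has_family n).
Proof.
apply: definable_ex.
have pL (k : 'I_n) i a : polyfun (fun e => family_of_env e k i a) by exact: polyfun_nth.
have pX (k l : 'I_n) i j a : polyfun (fun e =>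
    cross (family_of_env e k i) (family_of_env e l j) a).
  by rewrite /cross; apply: polyfunB; apply: polyfunM; apply: pL.
apply: (@definable_ext _ (fun e =>
  (forall k (i j l : 'I_7), (i != j) && (i != l) && (j != l) ->
     dot (cross (family_of_env e k i) (family_of_env e k j)) (family_of_env e k l) != 0) /\
  ((forall k (i j : 'I_7), (i < j)%N && ~~ adjacent i j ->
     qeval (coeffs_of_env e) (cross (family_of_env e k i) (family_of_env e k j)) = 0) /\
   (forall (k l : 'I_n), (k < l)%N -> exists i, forall j, exists a,
     cross (family_of_env e k i) (family_of_env e l j) a != 0)))).
  move=> e; split=> [[h1 [h2 h3]]|[h1 h2 h3]].
    split=> [k i j l ij il jl|k i j ij nadj|k l /h3[i iP]].
    - by apply: h1; rewrite ij il.
    - by apply: h2; rewrite ij.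
    - by exists i => j; apply/existsP; apply: iP.
  split=> [k i j l /andP[/andP[ij il] jl]|]; first exact: h1.
  split=> [k i j /andP[ij nadj]|k l /h3[i iP]]; first exact: h2.
  by exists i => j; apply/existsP; apply: iP.
apply: definable_and.
  do 4![apply: definable_all => ?]; apply: definable_if; apply: definable_neq0.
  by apply: polyfun_sum => a; apply: polyfunM; [apply: pX|apply: pL].
apply: definable_and.
  do 3![apply: definable_all => ?]; apply: definable_if; apply: definable_eq0.
  apply: polyfun_sum => m; apply: polyfunM; first exact: polyfun_nth.
  by apply: polyfun_prod => a; apply: polyfunX; apply: pX.
do 2![apply: definable_all => ?]; apply: definable_if; apply: definable_has => ?.
by apply: definable_all => ?; apply: definable_has => ?; apply: definable_neq0; apply: pX.
Qed.

Definition env_of_coeffs (w : 'I_15 -> C) : seq C := [seq w i | i <- enum 'I_15].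

Lemma nth_env_of_coeffs w (i : 'I_15) : nth 0 (env_of_coeffs w) i = w i.
Proof. by rewrite (nth_map i) ?size_enum_ord // nth_ord_enum. Qed.

Lemma quartic_monomials_nth m : m \in (quartic_monomials : seq _) ->
  exists i : 'I_15, m = tnth quartic_monomials i /\ index m quartic_monomials = i :> nat.
Proof.
move=> mq; have i15 : (index m quartic_monomials < 15)%N.
  by rewrite -index_mem size_tuple in mq.
by exists (Ordinal i15); rewrite (tnth_nth 0%MM) /= nth_index.
Qed.

Lemma qeval_ext (c d : 'X_{1..3} -> C) v :
  (forall m, m \in (quartic_monomials : seq _) -> c m = d m) -> qeval c v = qeval d v.
Proof.
by move=> cd; rewrite /qeval big_seq [RHS]big_seq; apply: eq_bigr => m /cd->.
Qed.

Lemma solution_family_ext n c d (L : family n) :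
  (forall m, m \in (quartic_monomials : seq _) -> c m = d m) ->
  solution_family c L -> solution_family d L.
Proof.
move=> cd [h1 h2 h3]; split=> // k i j ij nadj.
by rewrite -(h2 k i j ij nadj); apply: qeval_ext => m /cd.
Qed.

Lemma has_familyP n (w : 'I_15 -> C) (c : 'X_{1..3} -> C) :
  (forall i, c (tnth quartic_monomials i) = w i) ->
  has_family n (env_of_coeffs w) <-> exists L : family n, solution_family c L.
Proof.
move=> cw; have cE e : (forall i : 'I_15, nth 0 e i = w i) ->
    forall m, m \in (quartic_monomials : seq _) -> coeffs_of_env e m = c m.
  by move=> ew m /quartic_monomials_nth[i [-> iE]]; rewrite /coeffs_of_env iE ew cw.
split=> [[e eE sol]|[L sol]].
  exists (@family_of_env n e); apply: solution_family_ext sol; apply: cE => i.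
  by rewrite -eE ?nth_env_of_coeffs // mem_iota leqNgt ltn_ord.
(* Decodes p - 15 = (7 k + i) 3 + a by Euclidean division. *)
pose f (p : nat) : C := if (p < 15)%N then nth 0 (env_of_coeffs w) p else
  if insub ((p - 15) %/ 21)%N is Some k then
    L k (inord ((p - 15) %/ 3 %% 7)%N) (inord ((p - 15) %% 3)%N) else 0.
pose N := (15 + n * 21)%N; pose e := mkseq f N.
have eL : @family_of_env n e = L.
  apply: funext => k; apply: funext => i; apply: funext => a.
  have kn := ltn_ord k; have i7 := ltn_ord i; have a3 := ltn_ord a.
  rewrite /family_of_env; set p := ((k * 7 + i) * 3 + a)%N.
  have p3 : (p %/ 3 = k * 7 + i)%N by rewrite /p divnMDl // divn_small // addn0.
  have p21 : (p %/ 21 = k)%N.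
    have -> : (p %/ 21 = p %/ 3 %/ 7)%N := divnMA p 3 7.
    by rewrite p3 divnMDl // divn_small // addn0.
  have pn : (p < n * 21)%N by rewrite -ltn_divLR // p21.
  rewrite nth_mkseq ?ltn_add2l // /f -[X in (_ < X)%N]addn0 ltn_add2l ltn0 addKn p21.
  rewrite insubT /=; congr (L _ _ _); first exact: val_inj.
    by apply: val_inj; rewrite /= p3 modnMDl modn_small // inordK.
  by apply: val_inj; rewrite /= /p modnMDl modn_small // inordK.
exists e => [i|].
  rewrite mem_iota negb_and -ltnNge -leqNgt => /orP[i15|iN].
    by rewrite nth_mkseq ?(leq_trans i15) ?leq_addr // /f i15.
  rewrite !nth_default // ?size_mkseq // size_map size_enum_ord.
  by apply: leq_trans iN; apply: leq_addr.
rewrite eL; apply: solution_family_ext sol => m mq; apply/esym/cE => // i.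
rewrite nth_mkseq ?(leq_trans (ltn_ord i)) ?leq_addr // /f ltn_ord.
exact: nth_env_of_coeffs.
Qed.

Lemma zariski_open_pihomog (G : {mpoly C[15]}) : zariski_open (fun q =>
  exists d, (pihomog mdeg d G).@[quartic_coeffs q] != 0).
Proof.
exists (fun F => exists d, F = pihomog mdeg d G); split.
  by move=> _ [d ->]; exists d; apply: pihomogP.
move=> q _; split=> [[d dG]|[_ [d ->] dG]]; last by exists d.
by exists (pihomog mdeg d G) => //; exists d.
Qed.

Definition quartic_of_coeffs (w : 'I_15 -> C) : {mpoly C[3]} :=
  \sum_i w i *: 'X_[tnth quartic_monomials i].

Lemma quartic_of_coeffsK w i : quartic_coeffs (quartic_of_coeffs w) i = w i.
Proof.
rewrite /quartic_coeffs /quartic_of_coeffs raddf_sum (bigD1 i) //= mcoeffZ mcoeffX eqxx mulr1.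
rewrite big1 ?addr0 // => j ji; rewrite mcoeffZ mcoeffX.
case: eqP => [/(tuple_uniqP _ quartic_monomials_uniq) e|_]; last by rewrite mulr0.
by rewrite e eqxx in ji.
Qed.

Lemma quartic_of_coeffs_homog w : quartic_of_coeffs w \is 4.-homog.
Proof.
apply: rpred_sum => i _; apply: dhomogZ; rewrite dhomogX.
by have := mem_tnth i quartic_monomials; rewrite mem_quartic_monomials.
Qed.

End Counting.

Theorem proposition4p7 (R : realType) :
  generic_quartic (fun q : {mpoly R[i][3]} =>
    exists H : 'I_864 -> 'Z_7 -> {vspace 'rV[R[i]]_3},
      (forall k, heptagon (H k) /\ adjoint_curve (H k) q) /\
      (forall k l, k != l -> ~ same_heptagon (H k) (H l))).
Proof.
have [b [G [G0 GP]]] := definable_generic 15 (definable_has_family R 864).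
have [eps eps0 epsP] := near_fermat_solutions R.
pose f0 (i : 'I_15) : R[i] := fermat _ (tnth quartic_monomials i).
(* The bound 1/2 keeps the coefficient of x^4, which is 1 for the Fermat quartic, away from 0. *)
pose d : R := Num.min eps 2^-1.
have d0 : 0 < d by rewrite lt_min eps0 invr_gt0 ltr0n.
have dC : 0 < d%:C by rewrite ltcR.
have [w wf Gw] := mpoly_nonvanishing_near f0 G0 dC.
have wK i := quartic_of_coeffsK w i; set q0 := quartic_of_coeffs w in wK.
have q0_near m : m \in (quartic_monomials : seq _) -> `|q0@_m - fermat _ m| <= d%:C.
  by move=> /quartic_monomials_nth[i [-> _]]; have := wf i; rewrite -wK.
have q0N0 : q0 != 0.
  apply/eqP => q00; have := q0_near (monom3 4 0 0) isT.
  have -> : fermat R[i] (monom3 4 0 0) = 1.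
    rewrite /fermat (_ : [exists k, _]) //; apply/existsP; exists 0.
    by case: (monom3_nth 4 0 0) => ->.
  rewrite q00 mcoeff0 sub0r normrN normr1 -[1 in X in X <= _]/(1%:C) lecR.
  by rewrite le_min => /andP[_]; lra.
(* One point off the hypersurface at which the condition holds settles the generic truth value. *)
have Gb : b.
  apply/(GP w Gw)/(has_familyP 864 (c := fun m => q0@_m)); first exact: wK.
  apply: epsP => m /q0_near; move/le_trans; apply.
  by rewrite lecR ge_min lexx.
exists (fun q => exists e, (pihomog mdeg e G).@[quartic_coeffs q] != 0); split.
- exact: zariski_open_pihomog.
- exists q0; first by split; [|apply: quartic_of_coeffs_homog].
  have [e eP] := pihomog_nonvanishing Gw.
  by exists e; rewrite (meval_eq _ wK).
(* [G] itself may vanish at q, but not at t q, which defines the same curve and so has the same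
   heptagons. *)
move=> q qq [e /pihomog_nonvanishing_scale[t t0 Gt]].
have /(has_familyP 864 (c := fun m => t * q@_m))[//|L [genL L0 sepL]] :
  has_family 864 (env_of_coeffs (fun i => t * quartic_coeffs q i)).
  by apply/(GP _ Gt).
apply: (solution_family_heptagons (L := L)) => //; split=> // k i j ij nadj.
apply: (mulfI t0); rewrite mulr0 -[RHS](L0 k i j ij nadj) /qeval mulr_sumr.
by apply: eq_bigr => m _; rewrite mulrA.
Qed.
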